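(* Let $\mathfrak d=\sum_{i=1}^k Q_i(z)\frac{d^i}{dz^i}$ be a high-order Heun operator whose leading coefficient is monic with a zero at the origin, $Q_k(z)=z^{k+1}+a_kz^k+a_{k-1}z^{k-1}+\cdots+a_1z$, and let $z_{n,1},\dots,z_{n,n+1}$ be the zeros of its spectral polynomial $Sp_n$. For every fixed integer $m\ge 1$ the limit $$M_m(Q_k)=\lim_{n\to\infty}\frac1{n+1}\sum_{j=1}^{n+1}z_{n,j}^m$$ exists and is given by $$M_m(Q_k)=\int_0^1 \operatorname{CT}_w\Big[\big((1-\tau^k)w^{-1}-\tau^k(a_k+a_{k-1}w+\cdots+a_1w^{k-1})\big)^m\Big]\,d\tau .$$ Consequently every subsequential weak limit of the root-counting measures $\mu_n$ of $Sp_n$ has the same holomorphic moments $\int z^m\,d\mu(z)=M_m(Q_k)$, and these moments depend only on $Q_k$. The formula is affine-covariant: for an arbitrary high-order Heun operator (leading coefficient not necessarily monic and not necessarily vanishing at $0$), let $z=\alpha u+\beta$, $\alpha\neq0$, be any affine change of variable with $Q_k(\beta)=0$, and let $\widetilde Q(u)$ be the monic polynomial proportional to $Q_k(\alpha u+\beta)$. Then the limiting moments in the original coordinate, $\lim_{n\to\infty}\frac1{n+1}\sum_j z_{n,j}^m=\sum_{j=0}^m\binom mj\alpha^j\beta^{m-j}M_j(\widetilde Q)$ with $M_0=1$, are independent of the chosen affine normalization.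
   Context: Let $k\ge1$. A high-order Heun operator (Fuchs index one) is $\mathfrak d=\sum_{i=1}^kQ_i(z)\frac{d^i}{dz^i}$ with complex polynomials $Q_i$, $\deg Q_i\le i+1$, $\deg Q_k=k+1$. Write $Q_i(z)=\sum_{j=0}^{i+1}q_{i,j}z^j$ and $\lambda_n=\sum_{i=1}^kq_{i,i+1}\,n(n-1)\cdots(n-i+1)$. For given $n$, a Van Vleck polynomial is an at most linear polynomial $V$ such that $(\mathfrak d+V)S=0$ for some polynomial $S$ of degree exactly $n$. For all sufficiently large $n$ these have the form $V_{n,j}(z)=-\lambda_n(z-z_{n,j})$, $j=1,\dots,n+1$, counted with multiplicity, where the multiplicity of a Van Vleck root is its algebraic multiplicity as an eigenvalue of the operator $S\mapsto zS-\lambda_n^{-1}\mathfrak dS$ on the space $\mathrm{Pol}_{\le n}$ of polynomials of degree at most $n$ (this operator preserves $\mathrm{Pol}_{\le n}$). The $n$-th spectral polynomial is $Sp_n(z)=\prod_{j=1}^{n+1}(z-z_{n,j})$ and its root-counting measure is $\mu_n=\frac1{n+1}\sum_{j=1}^{n+1}\delta_{z_{n,j}}$. $\operatorname{CT}_w$ denotes the constant term of a Laurent polynomial in $w$. *)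

(* Defs.v *)
From HB Require Import structures.
From mathcomp Require Import all_boot all_order all_algebra.
From mathcomp Require Import all_classical all_reals all_analysis.
From mathcomp Require Import complex.

Set Implicit Arguments.
Unset Strict Implicit.
Unset Printing Implicit Defensive.

Import Order.TTheory GRing.Theory Num.Theory.
Import numFieldNormedType.Exports.

Local Open Scope classical_set_scope.
Local Open Scope ring_scope.

Notation "x %:F" := (tofrac x) : ring_scope.

(* Naming R[i] as a numClosedFieldType makes its topology, that of every
   numFieldType, available to inference. *)
Definition Cx (R : realType) : numClosedFieldType := R[i].

(* Only Q 1, ..., Q k matter; recall that size p is the degree plus one. *)
Definition high_order_heun (R : realType) (k : nat) (Q : nat -> {poly Cx R}) :=
  [/\ (0 < k)%N,
      forall i, (1 <= i <= k)%N -> (size (Q i) <= i.+2)%N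
    & size (Q k) = k.+2].

Definition heun_op (R : realType) (k : nat) (Q : nat -> {poly Cx R})
    (S : {poly Cx R}) : {poly Cx R} :=
  \sum_(1 <= i < k.+1) Q i * S^`(i).

Definition heun_lambda (R : realType) (k : nat) (Q : nat -> {poly Cx R})
    (n : nat) : Cx R :=
  \sum_(1 <= i < k.+1) (Q i)`_i.+1 * (n ^_ i)%:R.

Definition van_vleck (R : realType) (k : nat) (Q : nat -> {poly Cx R})
    (n : nat) (V : {poly Cx R}) : Prop :=
  (size V <= 2)%N /\
  exists S : {poly Cx R}, size S = n.+1 /\ heun_op k Q S + V * S = 0.

Definition spectral_op (R : realType) (k : nat) (Q : nat -> {poly Cx R})
    (n : nat) (S : {poly Cx R}) : {poly Cx R} :=
  'X * S - (heun_lambda k Q n)^-1 *: heun_op k Q S.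

(* Matrix of spectral_op on the polynomials of degree at most n in the monomial
   basis, acting on row vectors. When heun_lambda k Q n != 0 the operator
   preserves this space, so that poly_rV truncates nothing. *)
Definition spectral_mx (R : realType) (k : nat) (Q : nat -> {poly Cx R})
    (n : nat) : 'M[Cx R]_n.+1 :=
  lin1_mx (fun v : 'rV_n.+1 => poly_rV (spectral_op k Q n (rVpoly v))).

(* Zeros listed with multiplicity. *)
Definition zeros (R : realType) (p : {poly Cx R}) : seq (Cx R) :=
  sval (closed_field_poly_normal p).

(* The roots of the Van Vleck polynomials - lambda_n (z - x), each repeated
   according to its algebraic multiplicity as an eigenvalue of the operator. *)
Definition van_vleck_roots (R : realType) (k : nat) (Q : nat -> {poly Cx R})
    (n : nat) : seq (Cx R) :=
  [seq x <- zeros (char_poly (spectral_mx k Q n))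
     | `[< van_vleck k Q n (- heun_lambda k Q n *: ('X - x%:P)) >]].

Definition spectral_poly (R : realType) (k : nat) (Q : nat -> {poly Cx R})
    (n : nat) : {poly Cx R} :=
  \prod_(x <- van_vleck_roots k Q n) ('X - x%:P).

Definition mean_power (R : realType) (k : nat) (Q : nat -> {poly Cx R})
    (m n : nat) : Cx R :=
  n.+1%:R^-1 * \sum_(x <- zeros (spectral_poly k Q n)) x ^+ m.

Notation borelC R := (g_sigma_algebraType (@open (Cx R))).

Definition root_counting_measure (R : realType) (k : nat)
    (Q : nat -> {poly Cx R}) (n : nat) : {measure set (borelC R) -> \bar R} :=
  let zs := zeros (spectral_poly k Q n) in
  mscale (n.+1%:R^-1)%:nng
    (msum (fun j => \d_(nth 0 zs j : borelC R)) (size zs)).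

Definition weak_cvg (R : realType)
    (mu_ : nat -> {measure set (borelC R) -> \bar R})
    (mu : {measure set (borelC R) -> \bar R}) : Prop :=
  forall f : Cx R -> R, continuous f -> (exists M, forall x, `|f x| <= M) ->
    (\int[mu_ n]_x (f x)%:E)%E @[n --> \oo] --> (\int[mu]_x (f x)%:E)%E.

Definition subsequential_weak_limit (R : realType)
    (mu_ : nat -> {measure set (borelC R) -> \bar R})
    (mu : {measure set (borelC R) -> \bar R}) : Prop :=
  exists s : nat -> nat,
    {homo s : a b / (a < b)%N} /\ weak_cvg (fun n => mu_ (s n)) mu.

Definition Cintegrable (d : measure_display) (T : measurableType d)
    (R : realType) (mu : {measure set T -> \bar R}) (D : set T)
    (f : T -> Cx R) : Prop :=
  mu.-integrable D (fun x => (complex.Re (f x))%:E) /\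
  mu.-integrable D (fun x => (complex.Im (f x))%:E).

Definition Cintegral (d : measure_display) (T : measurableType d)
    (R : realType) (mu : {measure set T -> \bar R}) (D : set T)
    (f : T -> Cx R) : Cx R :=
  Complex (\int[mu]_(x in D) complex.Re (f x))
          (\int[mu]_(x in D) complex.Im (f x)).

(* Laurent polynomials in w are the fractions p(w) / w^N. The constant term of
   p / w^N is p`_N, whatever the representation (constant_termE below); 0 is a
   default value outside Laurent polynomials. *)
Definition constant_term (R : realType) (f : {fraction {poly Cx R}}) : Cx R :=
  xget 0 [set c | exists p N, f = p%:F / 'X%:F ^+ N /\ c = p`_N].

Lemma constant_termE (R : realType) (p : {poly Cx R}) (N : nat) :
  constant_term (p%:F / 'X%:F ^+ N) = p`_N.
Proof.
rewrite /constant_term; case: xgetP => [c _ [q [M [e ->]]]|/(_ p`_N)[]].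
  have X0 n : ('X : {poly Cx R})%:F ^+ n != 0.
    by rewrite -tofracXn tofrac_eq0 monic_neq0 // monicXn.
  move/eqP: e; rewrite eqr_div // -!tofracXn -!tofracM tofrac_eq => /eqP e.
  have := congr1 (fun r : {poly Cx R} => r`_(N + M)) e.
  by rewrite !coefMXn addnK addnC addnK !ltnNge leq_addr leq_addl.
by exists p, N.
Qed.

(* With a_j = P`_j: entries near row i of spectral_mx k Q n when i / n tends to t,
   where w lowers the degree by one. Meaningful for P monic of degree k + 1 with
   P(0) = 0. *)
Definition heun_symbol (R : realType) (k : nat) (P : {poly Cx R}) (t : R) :
    {fraction {poly Cx R}} :=
  let w : {fraction {poly Cx R}} := 'X%:F in
  let cst (c : Cx R) : {fraction {poly Cx R}} := c%:P%:F in
  cst (real_complex R (1 - t ^+ k)) * w^-1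
    - cst (real_complex R (t ^+ k)) * \sum_(j < k) cst P`_(k - j) * w ^+ j.

Definition heun_moment (R : realType) (k : nat) (P : {poly Cx R}) (m : nat) :
    Cx R :=
  Cintegral (@lebesgue_measure R) `[0, 1]
    (fun t => constant_term (heun_symbol k P t ^+ m)).

Lemma heun_moment0 (R : realType) (k : nat) (P : {poly Cx R}) :
  heun_moment k P 0 = 1.
Proof.
rewrite /heun_moment /Cintegral.
have ct1 t : constant_term (heun_symbol k P t ^+ 0) = 1.
  have := constant_termE (1 : {poly Cx R}) 0.
  by rewrite !expr0 tofrac1 divr1 coef1.
under eq_Rintegral do rewrite ct1 /=.
under [X in Complex _ X]eq_Rintegral do rewrite ct1 /=.
rewrite !Rintegral_cst //= lebesgue_measure_itv /= lte_fin ltr01.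
by rewrite oppr0 adde0 /= mul1r mul0r.
Qed.

Definition monic_multiple (R : realType) (p : {poly Cx R}) : {poly Cx R} :=
  (lead_coef p)^-1 *: p.

Definition affine_sub (R : realType) (a b : Cx R) (p : {poly Cx R}) :
    {poly Cx R} :=
  p \Po (a *: 'X + b%:P).

(* The moment of order m transported from the coordinate u, z = a u + b. *)
Definition affine_moment (R : realType) (k : nat) (P : {poly Cx R})
    (a b : Cx R) (m : nat) : Cx R :=
  \sum_(j < m.+1) 'C(m, j)%:R * a ^+ j * b ^+ (m - j)
                  * heun_moment k (monic_multiple (affine_sub a b P)) j.

(* Main.v *)
(* In the monomial basis the operator T_n : S |-> z S - d S / lambda_n is a banded
   matrix: T_n z^i is a combination of the z^(i+1-r), r <= k+1, and when i / n
   tends to t the coefficients tend to those of G_t(w) = w * symbol(t, w). Hence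
   the i-th diagonal entry of T_n^m tends to the coefficient of w^m in G_t^m, that
   is, to the constant term of the m-th power of the symbol. The mean of the
   diagonal of T_n^m is the integral over [0, 1] of a step function, so that
   dominated convergence gives the limit of tr(T_n^m) / (n + 1), which is the m-th
   moment of the eigenvalues. Since lambda_j <> lambda_n for j < n and n large,
   every eigenvector has degree n and every eigenvalue is a Van Vleck root. The
   absolute row sums of the matrices are bounded, hence so are the eigenvalues;
   weak limits thus have bounded support and keep the moments. An affine change of
   variable conjugates the operator of Q to a T' + b, where T' is the operator of a
   normalized family, and the moments follow by the binomial formula. *)
Require Import Defs.
From HB Require Import structures.
From mathcomp Require Import all_boot all_order all_algebra.
From mathcomp Require Import all_classical all_reals all_analysis.
From mathcomp Require Import measurable_realfun complex spectral ring lra zify.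

Set Implicit Arguments.
Unset Strict Implicit.
Unset Printing Implicit Defensive.

Import Order.TTheory GRing.Theory Num.Theory.
Import numFieldNormedType.Exports.

Local Open Scope classical_set_scope.
Local Open Scope ring_scope.

(** * Power sums of eigenvalues *)

Lemma zeros_prod (R : realType) (p : {poly Cx R}) :
  p \is monic -> \prod_(x <- zeros p) ('X - x%:P) = p.
Proof.
rewrite /zeros; case: closed_field_poly_normal => r /= {2}-> /monicP ->.
by rewrite scale1r.
Qed.

Lemma size_zeros (R : realType) (p : {poly Cx R}) :
  p \is monic -> size (zeros p) = (size p).-1.
Proof. by move=> /zeros_prod {2}<-; rewrite size_prod_XsubC. Qed.

Lemma mulmx_trig (F : fieldType) n (A B : 'M[F]_n) :
  is_trig_mx A -> is_trig_mx B ->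
  is_trig_mx (A *m B) /\ forall i, (A *m B) i i = A i i * B i i.
Proof.
move=> /is_trig_mxP tA /is_trig_mxP tB; split.
  apply/is_trig_mxP => i j ij; rewrite mxE big1 // => l _.
  case: (ltnP i l) => il; first by rewrite tA // mul0r.
  by rewrite tB ?mulr0 //; apply: leq_ltn_trans ij.
move=> i; rewrite mxE (bigD1 i) //= big1 ?addr0 // => l li.
case: (ltngtP i l) => il; first by rewrite tA // mul0r.
  by rewrite tB ?mulr0.
by rewrite (ord_inj il) eqxx in li.
Qed.

Lemma expmx_trig (F : fieldType) n (A : 'M[F]_n.+1) m :
  is_trig_mx A ->
  is_trig_mx (A ^+ m) /\ forall i, (A ^+ m) i i = A i i ^+ m.
Proof.
move=> tA; elim: m => [|m [tm dm]].
  split=> [|i]; last by rewrite !expr0 mxE eqxx.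
  by apply/is_trig_mxP => i j ij; rewrite expr0 mxE -val_eqE ltn_eqF.
rewrite exprS; have [tAm dAm] := mulmx_trig tA tm; split=> // i.
by rewrite exprS -dm -dAm.
Qed.

Lemma char_poly_conj (F : fieldType) n (P A : 'M[F]_n) :
  P \in unitmx -> char_poly (P *m A *m invmx P) = char_poly A.
Proof.
move=> uP; set P' := map_mx (@polyC F) P; set V' := map_mx (@polyC F) (invmx P).
have PV : P' *m V' = 1%:M by rewrite -map_mxM mulmxV // map_mx1.
rewrite /char_poly.
have -> : char_poly_mx (P *m A *m invmx P) = P' *m char_poly_mx A *m V'.
  rewrite /char_poly_mx mulmxBr mulmxBl !map_mxM; congr (_ - _).
  by rewrite -scalemx1 -scalemxAr mulmx1 -scalemxAl PV.
by rewrite !det_mulmx mulrAC -det_mulmx PV det1 mul1r.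
Qed.

Lemma exp_conjmx (F : fieldType) n (P A : 'M[F]_n.+1) m :
  P \in unitmx -> (P *m A *m invmx P) ^+ m = P *m A ^+ m *m invmx P.
Proof.
move=> uP; elim: m => [|m IH]; first by rewrite !expr0 mulmx1 mulmxV.
by rewrite !exprS IH -[_ * _]/(_ *m _) !mulmxA mulmxKV.
Qed.

Lemma mxtrace_conj (F : fieldType) n (P A : 'M[F]_n) :
  P \in unitmx -> \tr (P *m A *m invmx P) = \tr A.
Proof. by move=> uP; rewrite mxtrace_mulC mulmxA mulVmx // mul1mx. Qed.

(** Schur triangularization conjugates [A] to a triangular [B], whose diagonal lists the roots of
    the characteristic polynomial and, raised to the power m, is the diagonal of [B ^+ m]. *)
Lemma sum_zeros_char_poly (R : realType) n (A : 'M[Cx R]_n.+1) m :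
  \sum_(x <- zeros (char_poly A)) x ^+ m = \tr (A ^+ m).
Proof.
have [P /unitarymx_unit uP tP] := Schur A (ltn0Sn n).
set B := P *m A *m invmx P; have tB : is_trig_mx B by rewrite /B -conjumx.
have {2}-> : A = invmx P *m B *m invmx (invmx P).
  by rewrite invmxK /B !mulmxA mulVmx // mul1mx mulmxKV.
rewrite exp_conjmx ?unitmx_inv // mxtrace_conj ?unitmx_inv //.
have := zeros_prod (char_poly_monic A); rewrite -(char_poly_conj A uP) -/B.
rewrite [RHS]char_poly_trig // => e.
(* Equal products of monic linear factors have the same roots up to a permutation, to which a sum
   over the roots is insensitive. *)
have {}e : \prod_(x <- zeros (char_poly B)) ('X - x%:P)
   = \prod_(x <- [seq B i i | i : 'I_n.+1]) ('X - x%:P).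
  by rewrite e big_map enumT.
rewrite (perm_big _ (prod_XsubC_eq e)) big_map enumT.
by apply: eq_bigr => i _; rewrite (expmx_trig m tB).2.
Qed.

(** * The matrix of the spectral operator *)

Lemma heun_op_linear (R : realType) k (Q : nat -> {poly Cx R}) :
  linear (heun_op k Q).
Proof.
move=> c S U; rewrite /heun_op scaler_sumr -big_split /=.
by apply: eq_bigr => i _; rewrite linearP mulrDr scalerAr.
Qed.

Lemma spectral_op_linear (R : realType) k (Q : nat -> {poly Cx R}) n :
  linear (spectral_op k Q n).
Proof.
move=> c S U; rewrite /spectral_op heun_op_linear mulrDr scalerDr opprD.
by rewrite scalerBr addrACA -!scalerAr !scalerA [c * _]mulrC.
Qed.

HB.instance Definition _ (R : realType) k (Q : nat -> {poly Cx R}) n :=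
  GRing.isLinear.Build (Cx R) {poly Cx R} {poly Cx R} _ (spectral_op k Q n)
    (spectral_op_linear k Q n).

(* Coefficient of z^(i+1-r) in the image of z^i; it vanishes when r > i + 1, where
   the subtraction i.+1 - r of spectral_opXn truncates. *)
Definition heun_entry (R : realType) (k : nat) (Q : nat -> {poly Cx R})
    (n i r : nat) : Cx R :=
  (r == 0)%:R - (heun_lambda k Q n)^-1 *
    \sum_(1 <= l < k.+1 | (r <= l.+1)%N) (Q l)`_(l.+1 - r) * (i ^_ l)%:R.

Lemma spectral_opXn (R : realType) k (Q : nat -> {poly Cx R}) n i :
  (forall l, (1 <= l <= k)%N -> (size (Q l) <= l.+2)%N) ->
  spectral_op k Q n 'X^i
    = \sum_(r < k.+2) heun_entry k Q n i r *: 'X^(i.+1 - r).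
Proof.
move=> sQ; rewrite /spectral_op -exprS.
under eq_bigr do rewrite /heun_entry scalerBl.
rewrite sumrB; congr (_ - _).
  rewrite (bigD1 ord0) //= scale1r big1 ?addr0 // => r /negbTE.
  by rewrite -val_eqE /= => ->; rewrite scale0r.
under eq_bigr do rewrite -scalerA.
rewrite -scaler_sumr; congr (_ *: _).
under [RHS]eq_bigr do rewrite scaler_suml big_mkcond.
rewrite exchange_big /= /heun_op; apply: eq_big_nat => l /andP[l1 lk].
(* For [l > i] both sides vanish, since [i ^_ l] is 0; the exponent identity
   [(l.+1 - r) + (i - l) = i.+1 - r] used below needs [l <= i]. *)
rewrite derivnXn; have [il|li] := ltnP i l.
  rewrite ffact_small // !mulr0n mulr0 big1 // => r _.
  by case: ifP => // _; rewrite mulr0 scale0r.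
transitivity (\sum_(r < k.+2 | (r < l.+2)%N)
    ((Q l)`_(l.+1 - r) * (i ^_ l)%:R) *: 'X^(i.+1 - r)); last first.
  rewrite [LHS]big_mkcond; apply: eq_bigr => r _; rewrite ltnS.
  by case: ifP => // _; rewrite scale0r.
rewrite -(big_ord_widen _ (fun r => ((Q l)`_(l.+1 - r) * (i ^_ l)%:R) *: 'X^(i.+1 - r))) //.
have {1}-> : Q l = \poly_(j < l.+2) (Q l)`_j.
  apply/polyP => j; rewrite coef_poly; case: ltnP => // lj.
  by apply/nth_default/(leq_trans _ lj)/sQ; rewrite l1.
rewrite poly_def mulr_suml (reindex_inj rev_ord_inj) /=.
apply: eq_bigr => r _; rewrite subSS -scalerAl [in LHS]mulrnAr -exprD.
have -> : (l.+1 - r + (i - l) = i.+1 - r)%N by have := ltn_ord r; lia.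
by rewrite -scalerA scaler_nat.
Qed.

(** For [i = n] and [r = 0] the sum in [heun_entry] is [heun_lambda k Q n] by conversion: dividing
    by it cancels the term of degree n + 1 in the image of z^n. *)
Lemma heun_entry_top (R : realType) k (Q : nat -> {poly Cx R}) n :
  heun_lambda k Q n != 0 -> heun_entry k Q n n 0 = 0.
Proof.
by move=> l0; rewrite /heun_entry /= -[X in _ * X]/(heun_lambda k Q n) mulVf // subrr.
Qed.

Lemma spectral_op_sum (R : realType) k (Q : nat -> {poly Cx R}) n (S : {poly Cx R}) :
  spectral_op k Q n S = \sum_(i < size S) S`_i *: spectral_op k Q n 'X^i.
Proof.
have {1}-> : S = \sum_(i < size S) S`_i *: 'X^i by rewrite -poly_def coefK.
have -> := linear_sum (spectral_op k Q n : {linear _ -> _}).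
by apply: eq_bigr => i _; have -> := linearZ_LR (spectral_op k Q n : {linear _ -> _}).
Qed.

Lemma size_spectral_op (R : realType) k (Q : nat -> {poly Cx R}) n m (S : {poly Cx R}) :
  (forall l, (1 <= l <= k)%N -> (size (Q l) <= l.+2)%N) ->
  (size S <= m)%N -> (size (spectral_op k Q n S) <= m.+1)%N.
Proof.
move=> sQ sS; rewrite spectral_op_sum.
apply: (leq_trans (size_sum _ _ _)); apply/bigmax_leqP => i _.
apply: (leq_trans (size_scale_leq _ _)).
rewrite spectral_opXn //.
apply: (leq_trans (size_sum _ _ _)); apply/bigmax_leqP => r _.
apply: (leq_trans (size_scale_leq _ _)); rewrite size_polyXn.
by rewrite ltnS; apply: leq_trans (leq_subr _ _) (leq_trans (ltn_ord i) sS).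
Qed.

Lemma size_iter_spectral_op (R : realType) k (Q : nat -> {poly Cx R}) n p m (S : {poly Cx R}) :
  (forall l, (1 <= l <= k)%N -> (size (Q l) <= l.+2)%N) ->
  (size S <= p)%N -> (size (iter m (spectral_op k Q n) S) <= p + m)%N.
Proof.
by move=> sQ sS; elim: m => [|m IH]; rewrite ?addn0 // addnS size_spectral_op.
Qed.

Lemma spectral_op_stable (R : realType) k (Q : nat -> {poly Cx R}) n (S : {poly Cx R}) :
  (forall l, (1 <= l <= k)%N -> (size (Q l) <= l.+2)%N) ->
  heun_lambda k Q n != 0 ->
  (size S <= n.+1)%N -> (size (spectral_op k Q n S) <= n.+1)%N.
Proof.
move=> sQ l0 sS.
have sX i : (i < n.+1)%N -> (size (spectral_op k Q n 'X^i) <= n.+1)%N.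
  move=> ilt; rewrite spectral_opXn // big_ord_recl /=.
  apply: (leq_trans (size_polyD _ _)); rewrite geq_max; apply/andP; split.
    have [->|ni] := eqVneq i n.
      by rewrite heun_entry_top // scale0r size_poly0.
    by apply: (leq_trans (size_scale_leq _ _)); rewrite size_polyXn; lia.
  apply: (leq_trans (size_sum _ _ _)); apply/bigmax_leqP => r _.
  apply: (leq_trans (size_scale_leq _ _)); rewrite size_polyXn /bump.
  by have := ltn_ord r; lia.
rewrite spectral_op_sum.
apply: (leq_trans (size_sum _ _ _)); apply/bigmax_leqP => i _.
apply: (leq_trans (size_scale_leq _ _)).
exact/sX/(leq_trans (ltn_ord i)).
Qed.

(** [spectral_mx] and [affine_mx] apply [lin1_mx] to bare functions, so linearity enters as a
    hypothesis and is bundled here. *)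
Lemma mul_rV_linear1 (K : pzRingType) m n (f : 'rV[K]_m -> 'rV[K]_n) v :
  linear f -> v *m lin1_mx f = f v.
Proof.
move=> lf; pose L := GRing.isLinear.Build K _ _ _ f lf.
pose F : {linear 'rV[K]_m -> 'rV[K]_n} := HB.pack f L.
exact: (mul_rV_lin1 F).
Qed.

Lemma mul_spectral_mx (R : realType) k (Q : nat -> {poly Cx R}) n v :
  (forall l, (1 <= l <= k)%N -> (size (Q l) <= l.+2)%N) ->
  heun_lambda k Q n != 0 ->
  rVpoly (v *m spectral_mx k Q n) = spectral_op k Q n (rVpoly v).
Proof.
move=> sQ l0; rewrite mul_rV_linear1.
  by rewrite poly_rV_K // spectral_op_stable // size_poly.
by move=> c u w; rewrite [rVpoly _]linearP spectral_op_linear linearP.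
Qed.

(** Matrix powers become iterates on polynomials, whose coefficients can be followed by induction on
    m without regard to the boundary of the matrix. *)
Lemma spectral_mx_expE (R : realType) k (Q : nat -> {poly Cx R}) n m (i j : 'I_n.+1) :
  (forall l, (1 <= l <= k)%N -> (size (Q l) <= l.+2)%N) ->
  heun_lambda k Q n != 0 ->
  (spectral_mx k Q n ^+ m) i j = (iter m (spectral_op k Q n) 'X^i)`_j.
Proof.
move=> sQ l0; pose d : 'rV[Cx R]_n.+1 := delta_mx 0 i.
have -> : (spectral_mx k Q n ^+ m) i j
   = (rVpoly (d *m spectral_mx k Q n ^+ m))`_j.
  by rewrite coef_rVpoly_ord -rowE mxE.
suff -> : rVpoly (d *m spectral_mx k Q n ^+ m)
   = iter m (spectral_op k Q n) 'X^i by [].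
elim: m => [|m IH].
  by rewrite expr0 mulmx1 rVpoly_delta.
by rewrite exprSr -[_ * _]/(_ *m _) mulmxA mul_spectral_mx // IH.
Qed.

(** * Limits of sequences *)

Section complex_limits.
Variable R : realType.

Lemma normc_ge_Im (x : R[i]) : (real_complex R `|complex.Im x|) <= `|x|.
Proof.
rewrite normc_def lecR -sqrtr_sqr ler_wsqrtr // lerDr sqr_ge0 //.
Qed.

Lemma real_complex_norm (r : R) : `|real_complex R r : Cx R| = real_complex R `|r|.
Proof. by rewrite normc_def /= expr0n /= addr0 sqrtr_sqr. Qed.

(** The order of [Cx R] compares only numbers with equal imaginary parts, so the radii of its balls
    are real numbers in disguise. *)
Lemma gtr0_ReE (e : Cx R) : 0 < e -> exists2 r : R, 0 < r & e = real_complex R r.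
Proof.
by case: e => a b; rewrite ltcE /= => /andP[/eqP -> a0]; exists a.
Qed.

Context {T : Type} {F : set_system T} {FF : Filter F}.

Lemma cvg_real_complex (u : T -> R) (l : R) :
  u x @[x --> F] --> l -> (real_complex R (u x) : Cx R) @[x --> F] --> (real_complex R l : Cx R).
Proof.
move=> /cvgrPdist_lt ul; apply/cvgrPdist_lt => e /gtr0_ReE[r r0 ->].
apply: filterS (ul r r0) => x h.
by rewrite -[_ - _]/(real_complex R l - real_complex R (u x)) -rmorphB real_complex_norm ltcR.
Qed.

Lemma cvg_complex_Re (f : T -> Cx R) (l : Cx R) :
  f x @[x --> F] --> l -> complex.Re (f x) @[x --> F] --> complex.Re l.
Proof.
move=> /cvgrPdist_lt ul; apply/cvgrPdist_lt => e e0.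
have e0' : 0 < (real_complex R e : Cx R) by rewrite ltcR.
apply: filterS (ul _ e0') => x h; rewrite -ltcR.
apply: le_lt_trans h; have := normc_ge_Re (l - f x).
by case: (l) (f x) => [a b] [c d].
Qed.

Lemma cvg_complex_Im (f : T -> Cx R) (l : Cx R) :
  f x @[x --> F] --> l -> complex.Im (f x) @[x --> F] --> complex.Im l.
Proof.
move=> /cvgrPdist_lt ul; apply/cvgrPdist_lt => e e0.
have e0' : 0 < (real_complex R e : Cx R) by rewrite ltcR.
apply: filterS (ul _ e0') => x h; rewrite -ltcR.
apply: le_lt_trans h; have := normc_ge_Im (l - f x).
by case: (l) (f x) => [a b] [c d].
Qed.

Lemma cvg_complex (f : T -> Cx R) (l : Cx R) :
  complex.Re (f x) @[x --> F] --> complex.Re l ->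
  complex.Im (f x) @[x --> F] --> complex.Im l ->
  f x @[x --> F] --> l.
Proof.
move=> hr hi; rewrite (complexE l) (_ : f = fun x => real_complex R (complex.Re (f x))
  + 'i%C * real_complex R (complex.Im (f x))); last first.
  by apply/funext => x; rewrite -complexE.
apply: cvgD; first exact: cvg_real_complex.
by apply: cvgM; [exact: cvg_cst|exact: cvg_real_complex].
Qed.

End complex_limits.
Arguments cvg_real_complex {R T F FF} u l.
Arguments cvg_complex_Re {R T F FF} f l.
Arguments cvg_complex_Im {R T F FF} f l.
Arguments cvg_complex {R T F FF} f l.

Lemma cvg_bigsum (K : numFieldType) (T : Type) (F : set_system T) (FF : Filter F)
    (I : eqType) (r : seq I) (P : pred I) (f : I -> T -> K) (l : I -> K) :
  (forall i, i \in r -> P i -> f i x @[x --> F] --> l i) ->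
  \sum_(i <- r | P i) f i x @[x --> F] --> \sum_(i <- r | P i) l i.
Proof.
elim: r => [|i r IH] fl.
  by rewrite big_nil; under eq_fun do rewrite big_nil; exact: cvg_cst.
have {}IH := IH (fun j jr => fl j (@mem_behead _ (i :: r) j jr)).
rewrite big_cons; under eq_fun do rewrite big_cons.
by case: ifP => // Pi; apply: cvgD => //; apply: fl => //; exact: mem_head.
Qed.

Lemma cvg_near_eq (T : Type) (U : topologicalType) (F : set_system T)
    {FF : Filter F} (f g : T -> U) (l : U) :
  (\forall x \near F, f x = g x) -> f x @[x --> F] --> l -> g x @[x --> F] --> l.
Proof.
move=> fg; apply: cvg_trans; apply: near_eq_cvg.
by apply: filterS fg.
Qed.

Section ratio.
Variable R : realType.

Lemma cvg_inv_nat : (n%:R^-1 : R) @[n --> \oo] --> (0 : R).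
Proof.
by rewrite -(cvg_shiftS (fun n => n%:R^-1 : R)); exact: cvg_harmonic.
Qed.

Lemma cvg_ratio_shift (s s' : nat -> nat) (c : nat) (t : R) :
  (s n)%:R / n%:R @[n --> \oo] --> t ->
  (forall n, (s n <= s' n + c)%N /\ (s' n <= s n + c)%N) ->
  (s' n)%:R / n%:R @[n --> \oo] --> t.
Proof.
move=> st ss; have c0 : c%:R * n%:R^-1 @[n --> \oo] --> (0 : R).
  by rewrite -(mulr0 c%:R); apply: cvgM; [exact: cvg_cst|exact: cvg_inv_nat].
apply: (@squeeze_cvgr _ _ _ R (fun n => (s n)%:R / n%:R - c%:R * n%:R^-1)
   (fun n => (s n)%:R / n%:R + c%:R * n%:R^-1)).
- apply: nearW => n; have [s1 s2] := ss n.
  have n0 : 0 <= (n%:R^-1 : R) by rewrite invr_ge0.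
  rewrite -mulrBl -mulrDl !ler_wpM2r // ?lerBlDr -natrD ler_nat //.
- by rewrite -[X in _ --> X]subr0; apply: cvgB.
- by rewrite -[X in _ --> X]addr0; apply: cvgD.
Qed.

Lemma cvg_ratio_ffact (s : nat -> nat) (t : R) l :
  (s n)%:R / n%:R @[n --> \oo] --> t ->
  (s n ^_ l)%:R / n%:R ^+ l @[n --> \oo] --> t ^+ l.
Proof.
move=> st; elim: l => [|l IH].
  by rewrite expr0; under eq_fun do rewrite expr0 divr1 ffactn0; exact: cvg_cst.
rewrite exprSr; under eq_fun do rewrite ffactnSr natrM exprSr invfM mulrACA.
apply: cvgM => //; apply: (@cvg_ratio_shift s _ l) => // n; lia.
Qed.

(** Division by n^k kills every derivative of order below k; this is why only Q_k survives in the
    limit. *)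
Lemma cvg_ratio_ffact_le (s : nat -> nat) (t : R) l k : (l <= k)%N ->
  (s n)%:R / n%:R @[n --> \oo] --> t ->
  (s n ^_ l)%:R / n%:R ^+ k @[n --> \oo] --> (l == k)%:R * t ^+ k.
Proof.
move=> lk st; have [->|nlk] := eqVneq l k; first by rewrite mul1r; exact: (cvg_ratio_ffact).
rewrite mul0r -(mulr0 (t ^+ l)).
have h : n%:R^-1 ^+ (k - l) @[n --> \oo] --> (0 : R).
  have : (0 < k - l)%N by lia.
  case: (k - l)%N => // j _; elim: j => [|j IH].
    exact: cvg_inv_nat.
  under eq_fun do rewrite exprS; rewrite -(mulr0 0).
  by apply: cvgM => //; exact: cvg_inv_nat.
apply: (@cvg_near_eq nat R \oo _
  (fun n => (s n ^_ l)%:R / n%:R ^+ l * n%:R^-1 ^+ (k - l))); last first.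
  by apply: cvgM => //; exact: (cvg_ratio_ffact).
apply: nearW => n /=.
by rewrite -mulrA exprVn -invfM -exprD subnKC.
Qed.

Lemma cvg_ratio_id : n%:R / n%:R @[n --> \oo] --> (1 : R).
Proof.
apply: (@cvg_near_eq nat R \oo _ (fun=> 1)); last exact: cvg_cst.
by near=> n; rewrite /= divff // pnatr_eq0 -lt0n; near: n; exact: nbhs_infty_gt.
Unshelve. all: by end_near. Qed.

End ratio.
Arguments cvg_near_eq {T U F FF} f g l.
Arguments cvg_ratio_shift {R} s s' c t.
Arguments cvg_ratio_ffact {R} s t l.
Arguments cvg_ratio_ffact_le {R} s t l k.
Arguments cvg_ratio_id R : clear implicits.

(** * Asymptotics of heun_lambda *)

Section lambda.
Variable R : realType.

Lemma real_complex_nat (n : nat) : real_complex R n%:R = n%:R :> Cx R.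
Proof. exact: rmorph_nat. Qed.

Lemma near_nat_gt (z : Cx R) : \forall n \near \oo, `|z| < n%:R.
Proof.
have [r r0 zr] : exists2 r : R, 0 < r & `|z| + 1 = real_complex R r.
  by apply: gtr0_ReE; rewrite ltr_wpDl.
near=> n; apply: (@lt_trans _ _ (`|z| + 1)); first by rewrite ltrDl.
by rewrite zr -real_complex_nat ltcR; near: n; exact: nbhs_infty_gtr.
Unshelve. all: by end_near. Qed.

(* (p(n) - p(j)) / (n - j) = \sum_s p_s h_s, where h_s is the complete homogeneous
   polynomial of degree s - 1 in n and j; the top term dominates the others since
   n^(s-1) <= h_s <= s n^(s-1). *)
Lemma horner_nat_inj (p : {poly Cx R}) : (1 < size p)%N ->
  \forall n \near \oo, forall j, (j < n)%N -> p.[n%:R] != p.[j%:R].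
Proof.
move=> sp; set k := (size p).-2; have spk : size p = k.+2.
  by rewrite /k; case: size sp => [|[]].
pose B : Cx R := \sum_(s < k.+1) `|p`_s| * s%:R.
have pk0 : 0 < `|p`_k.+1|.
  by rewrite normr_gt0 -[k.+1]/(k.+2.-1) -spk -lead_coefE lead_coef_eq0 -size_poly_gt0 spk.
near=> n => j jn; apply/eqP => pnj.
pose h (s : nat) : Cx R := \sum_(i < s) n%:R ^+ (s.-1 - i) * j%:R ^+ i.
have n0 : (0 < n)%N by apply: leq_ltn_trans jn.
have h0 s : 0 <= h s by apply: sumr_ge0 => i _; rewrite mulr_ge0 // exprn_ge0.
have hle s : h s.+1 <= s.+1%:R * n%:R ^+ s.
  apply: (@le_trans _ _ (\sum_(i < s.+1) n%:R ^+ s)); last first.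
    by rewrite sumr_const card_ord mulr_natl.
  apply: ler_sum => i _ /=; rewrite -[X in _ <= _ ^+ X](@subnK i) ?exprD -1?ltnS //.
  by rewrite ler_wpM2l ?exprn_ge0 // lerXn2r ?nnegrE // ler_nat ltnW.
have hge : n%:R ^+ k <= h k.+1.
  rewrite /h big_ord_recl /= expr0 mulr1 subn0 lerDl; apply: sumr_ge0 => i _.
  by rewrite mulr_ge0 // exprn_ge0.
have sum0 : \sum_(s < k.+2) p`_s * h s = 0.
  have nj : (n%:R - j%:R : Cx R) != 0 by rewrite -natrB 1?ltnW // pnatr_eq0 subn_eq0 -ltnNge.
  apply: (mulfI nj); rewrite mulr0 mulr_sumr.
  transitivity (p.[n%:R] - p.[j%:R]); last by rewrite pnj subrr.
  rewrite !horner_coef spk -sumrB; apply: eq_bigr => s _.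
  by rewrite -mulrBr subrXX mulrCA.
move: sum0; rewrite big_ord_recr /= => /eqP; rewrite addrC addr_eq0 => /eqP /(congr1 Num.norm).
rewrite normrN normrM (ger0_norm (h0 _)) => hk.
(* Thanks to the extra factor n, each lower term is at most a constant times n^k. Dividing by n^k
   leaves [n * |p_(k+1)| <= B], which fails for large n. *)
have : n%:R * (`|p`_k.+1| * n%:R ^+ k) <= B * n%:R ^+ k.
  apply: (@le_trans _ _ (n%:R * (`|p`_k.+1| * h k.+1))).
    by rewrite !ler_wpM2l // ltW.
  rewrite hk; apply: (@le_trans _ _ (n%:R * \sum_(s < k.+1) `|p`_s * h s|)).
    by rewrite ler_wpM2l // ler_norm_sum.
  rewrite mulr_sumr /B mulr_suml; apply: ler_sum => -[[|s] sk] _ /=.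
    by rewrite /h big_ord0 !mulr0 normr0 mulr0 mul0r.
  rewrite normrM mulrCA -mulrA ler_wpM2l // ger0_norm //.
  apply: (@le_trans _ _ (n%:R * (s.+1%:R * n%:R ^+ s))); first by rewrite ler_wpM2l.
  rewrite mulrCA -exprS ler_wpM2l // ler_weXn2l // ler1n //.
rewrite mulrA ler_pM2r ?exprn_gt0 ?ltr0n // -ler_pdivlMr //.
have B0 : 0 <= B by apply: sumr_ge0 => i _; rewrite mulr_ge0.
move=> nB; have : `|B / `|p`_k.+1| | < n%:R by near: n; exact: near_nat_gt.
by rewrite ger0_norm ?divr_ge0 // => /lt_le_trans/(_ nB); rewrite ltxx.
Unshelve. all: by end_near. Qed.

Definition falling_poly (l : nat) : {poly Cx R} := \prod_(j < l) ('X - j%:R%:P).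

Lemma size_falling_poly l : size (falling_poly l) = l.+1.
Proof.
rewrite /falling_poly -(big_mkord xpredT (fun j => 'X - j%:R%:P)).
by rewrite size_prod_XsubC size_iota subn0.
Qed.

Lemma horner_falling_poly l n : (falling_poly l).[n%:R] = (n ^_ l)%:R.
Proof.
rewrite /falling_poly; elim: l => [|l IH]; first by rewrite big_ord0 hornerC ffactn0.
rewrite big_ord_recr hornerM IH /= hornerXsubC ffactnSr natrM.
have [ln|nl] := leqP l n; first by rewrite natrB.
by rewrite ffact_small // !mul0r.
Qed.

Variables (k : nat) (Q : nat -> {poly Cx R}).
Hypothesis hQ : high_order_heun k Q.

Lemma heun_lead_neq0 : (Q k)`_k.+1 != 0.
Proof.
have [_ _ sk] := hQ.
by rewrite -[k.+1]/(k.+2.-1) -sk -lead_coefE lead_coef_eq0 -size_poly_gt0 sk.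
Qed.

(** lambda_n is the value at n of a polynomial of degree k >= 1, because [falling_poly k] enters
    with the nonzero leading coefficient of Q_k. *)
Lemma near_heun_lambda_inj :
  \forall n \near \oo, forall j, (j < n)%N -> heun_lambda k Q n != heun_lambda k Q j.
Proof.
have [k0 _ sk] := hQ.
pose p := \sum_(1 <= l < k.+1) (Q l)`_l.+1 *: falling_poly l.
have pE n : heun_lambda k Q n = p.[n%:R].
  rewrite /p horner_sum; apply: eq_bigr => l _.
  by rewrite hornerZ horner_falling_poly.
have sp : (1 < size p)%N.
  rewrite /p big_nat_recr //= addrC size_polyDl size_scale ?heun_lead_neq0 ?size_falling_poly //.
  apply: (leq_ltn_trans (size_sum _ _ _)); rewrite big_seq_cond.
  rewrite ltnS; apply/bigmax_leqP_seq => l; rewrite mem_index_iota => /andP[_ lk] _.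
  by apply: (leq_trans (size_scale_leq _ _)); rewrite size_falling_poly.
by apply: filterS (horner_nat_inj sp) => n h j jn; rewrite !pE h.
Qed.

Lemma cvg_heun_lambda : heun_lambda k Q n / n%:R ^+ k @[n --> \oo] --> (Q k)`_k.+1.
Proof.
have [k0 _ _] := hQ.
have -> : (Q k)`_k.+1 = \sum_(1 <= l < k.+1) (Q l)`_l.+1 * (l == k)%:R.
  rewrite big_nat_recr //= eqxx mulr1 big_nat big1 ?add0r // => l /andP[_ lk].
  by rewrite ltn_eqF // mulr0.
rewrite /heun_lambda; under eq_fun do rewrite mulr_suml.
apply: cvg_bigsum => l; rewrite mem_index_iota => /andP[_ lk] _.
under eq_fun do rewrite -mulrA; apply: cvgM; first exact: cvg_cst.
apply: (@cvg_near_eq nat (Cx R) \oo _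
  (fun n => real_complex R ((n ^_ l)%:R / n%:R ^+ k))); last first.
  rewrite -real_complex_nat; apply: cvg_real_complex.
  by have := cvg_ratio_ffact_le id 1 l k lk (cvg_ratio_id R); rewrite expr1n mulr1.
by apply: nearW => n; rewrite rmorphM fmorphV rmorphXn /= !real_complex_nat.
Qed.

Lemma near_heun_lambda_neq0 : \forall n \near \oo, heun_lambda k Q n != 0.
Proof.
have : \forall n \near \oo, heun_lambda k Q n / n%:R ^+ k != 0.
  exact: (cvgr_neq0 _ cvg_heun_lambda heun_lead_neq0).
by apply: filterS => n; apply: contraNneq => ->; rewrite mul0r.
Qed.

Lemma cvg_heun_lambdaV :
  n%:R ^+ k / heun_lambda k Q n @[n --> \oo] --> ((Q k)`_k.+1)^-1.
Proof.
under eq_fun do rewrite -invf_div.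
by apply: cvgV; [exact: heun_lead_neq0|exact: cvg_heun_lambda].
Qed.

End lambda.

(** * Limits of the entries *)

Section symbol.
Variables (R : realType) (k : nat).

(** The polynomial G_t(w) = w * symbol(t, w) when [P]_k.+1 = 1[and]P[_0 = 0]. For P = Q_k its
    coefficient at w^r is the limit of [heun_entry k Q n i r] as i / n tends to t. *)
Definition symbol_poly (P : {poly Cx R}) (t : R) : {poly Cx R} :=
  \poly_(r < k.+2) ((r == 0)%:R - real_complex R (t ^+ k) * P`_(k.+1 - r)).

Lemma heun_symbolE (P : {poly Cx R}) (t : R) :
  P`_k.+1 = 1 -> P`_0 = 0 -> heun_symbol k P t = (symbol_poly P t)%:F / 'X%:F.
Proof.
move=> P1 P0; have X0 : ('X : {poly Cx R})%:F != 0 by rewrite tofrac_eq0 polyX_eq0.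
apply: (mulIf X0); rewrite mulfVK // /heun_symbol mulrBl mulfVK //.
rewrite -mulrA mulr_suml /symbol_poly poly_def big_ord_recl big_ord_recr /=.
rewrite subnn P0 mulr0 subr0 scale0r addr0 P1 mulr1 expr0 alg_polyC.
rewrite tofracD; congr (_%:F + _).
  by rewrite rmorphB rmorph1.
rewrite -[RHS]/(tofrac _) rmorph_sum /= mulr_sumr -sumrN.
apply: eq_bigr => j _; rewrite /bump /= sub0r add1n subSS.
rewrite -tofracXn -!tofracM -tofracN; congr tofrac.
by rewrite -mul_polyC polyCN polyCM mulNr -!mulrA exprSr.
Qed.

Lemma constant_term_heun_symbol (P : {poly Cx R}) (t : R) m :
  P`_k.+1 = 1 -> P`_0 = 0 ->
  constant_term (heun_symbol k P t ^+ m) = (symbol_poly P t ^+ m)`_m.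
Proof.
by move=> P1 P0; rewrite heun_symbolE // expr_div_n -tofracXn constant_termE.
Qed.

Variable Q : nat -> {poly Cx R}.
Hypothesis hQ : high_order_heun k Q.
Hypothesis Q1 : (Q k)`_k.+1 = 1.

Lemma cvg_heun_entry (s : nat -> nat) (t : R) r : (r < k.+2)%N ->
  (s n)%:R / n%:R @[n --> \oo] --> t ->
  heun_entry k Q n (s n) r @[n --> \oo] -->
    ((r == 0)%:R - real_complex R (t ^+ k) * (Q k)`_(k.+1 - r) : Cx R).
Proof.
move=> rk st; have [k0 _ _] := hQ.
apply: cvgB; first exact: cvg_cst.
(* The limit is spread over all l, so that convergence can be proved termwise: the terms with
   [l < k] are 0, and the factor 1 is the limit of n^k / lambda_n, Q_k being monic. *)
have -> : real_complex R (t ^+ k) * (Q k)`_(k.+1 - r) =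
   \sum_(1 <= l < k.+1 | (r <= l.+1)%N)
      (Q l)`_(l.+1 - r) * (real_complex R ((l == k)%:R * t ^+ k) * 1).
  rewrite big_mkcond big_nat_recr //= -ltnS rk eqxx mul1r mulr1 mulrC.
  rewrite big_nat big1 ?add0r // => l /andP[_ lk].
  by rewrite ltn_eqF // mul0r mul0r mulr0 if_same.
apply: (@cvg_near_eq nat (Cx R) \oo _ (fun n => \sum_(1 <= l < k.+1 | (r <= l.+1)%N)
      (Q l)`_(l.+1 - r) * (real_complex R ((s n ^_ l)%:R / n%:R ^+ k)
        * (n%:R ^+ k / heun_lambda k Q n)))).
  near=> n; rewrite mulr_sumr; apply: eq_bigr => l _.
  rewrite rmorphM fmorphV rmorphXn /= !real_complex_nat mulrA.
  have n0 : (n%:R ^+ k : Cx R) != 0.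
    by rewrite expf_neq0 // pnatr_eq0 -lt0n; near: n; exact: nbhs_infty_gt.
  by rewrite -!mulrA mulKf // [LHS]mulrA [RHS]mulrC.
apply: cvg_bigsum => l; rewrite mem_index_iota => /andP[_ lk] _.
apply: cvgM; first exact: cvg_cst.
apply: cvgM; first by apply: cvg_real_complex; exact: cvg_ratio_ffact_le.
by have := cvg_heun_lambdaV hQ; rewrite Q1 invr1.
Unshelve. all: by end_near. Qed.

Lemma near_ratio_gt (s : nat -> nat) (t : R) c : 0 < t ->
  (s n)%:R / n%:R @[n --> \oo] --> t -> \forall n \near \oo, (c <= s n)%N.
Proof.
move=> t0 st; have t2 : t / 2 < t by lra.
have h : \forall n \near \oo, t / 2 < (s n)%:R / n%:R by exact: (cvgr_gt _ st).
near=> n; have : t / 2 < (s n)%:R / n%:R by near: n.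
have n0 : 0 < (n%:R : R) by rewrite ltr0n; near: n; exact: nbhs_infty_gt.
rewrite ltr_pdivlMr // => h1.
have : c%:R / (t / 2) < n%:R by near: n; exact: nbhs_infty_gtr.
by rewrite ltr_pdivrMr ?divr_gt0 // mulrC => /lt_trans/(_ h1); rewrite ltr_nat => /ltnW.
Unshelve. all: by end_near. Qed.

(* The hypothesis 0 < t keeps the exponent s n away from 0, so that none of the
   natural subtractions truncates for n large. *)
Lemma cvg_iter_spectral_op (t : R) m p (s : nat -> nat) : 0 < t ->
  (s n)%:R / n%:R @[n --> \oo] --> t ->
  (iter m (spectral_op k Q n) 'X^(s n))`_(s n + m - p) @[n --> \oo]
    --> (symbol_poly (Q k) t ^+ m)`_p.
Proof.
move=> t0; have [k0 sQ _] := hQ; elim: m p s => [|m IH] p s st.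
  apply: (@cvg_near_eq nat (Cx R) \oo _ (fun=> (1 : {poly Cx R})`_p)); last exact: cvg_cst.
  near=> n; have ps : (p <= s n)%N by near: n; exact: (near_ratio_gt p t0 st).
  by rewrite /= addn0 coefXn coef1; congr (_%:R); apply/eqP/eqP; lia.
have -> : (symbol_poly (Q k) t ^+ m.+1)`_p = \sum_(r < k.+2)
    ((r == 0 :> nat)%:R - real_complex R (t ^+ k) * (Q k)`_(k.+1 - r)) *
      (if (p < r)%N then 0 else (symbol_poly (Q k) t ^+ m)`_(p - r)).
  rewrite exprS {1}/symbol_poly poly_def mulr_suml coef_sum.
  by apply: eq_bigr => r _; rewrite -scalerAl coefZ coefXnM.
apply: (@cvg_near_eq nat (Cx R) \oo _ (fun n => \sum_(r < k.+2)
   heun_entry k Q n (s n) r *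
   (if (p < r)%N then 0 else
     (iter m (spectral_op k Q n) 'X^((s n).+1 - r))`_((s n).+1 - r + m - (p - r))))).
  near=> n; have ps : (p + k < s n)%N by near: n; exact: (near_ratio_gt _ t0 st).
  have -> : iter m.+1 (spectral_op k Q n) 'X^(s n) =
    \sum_(r < k.+2) heun_entry k Q n (s n) r *: iter m (spectral_op k Q n) 'X^((s n).+1 - r).
    rewrite iterSr spectral_opXn //; elim: (m) => [//|m' IHm].
    rewrite iterS IHm (linear_sum (spectral_op k Q n : {linear _ -> _})).
    by apply: eq_bigr => r _; have -> := linearZ_LR (spectral_op k Q n : {linear _ -> _}).
  rewrite coef_sum; apply: eq_bigr => r _; rewrite coefZ; congr (_ * _).
  (* If [p < r], the target degree exceeds s n + 1 - r + m, the highest that m further applications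
     can reach. *)
  case: ltnP => pr.
    apply/esym/nth_default.
    apply: (leq_trans (size_iter_spectral_op _ _ _ (leqnn _))) => //.
    by rewrite size_polyXn; have := ltn_ord r; lia.
  by congr (_ `_ _); lia.
apply: cvg_bigsum => r _ _; apply: cvgM.
  by apply: cvg_heun_entry => //.
case: ltnP => pr; first exact: cvg_cst.
apply: (IH (p - r)%N (fun n => (s n).+1 - r)%N).
apply: (cvg_ratio_shift s _ k.+2) => // n.
by have := ltn_ord r; lia.
Unshelve. all: by end_near. Qed.

End symbol.

(** * Bounds on the spectrum *)

Section row_sums.
Variables (K : numFieldType) (n : nat) (A : 'M[K]_n.+1) (C : K).
Hypothesis AC : forall i, \sum_j `|A i j| <= C.

(** The maximal absolute row sum is a submultiplicative norm. *)
Lemma row_sum_exp m i : \sum_j `|(A ^+ m) i j| <= C ^+ m.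
Proof.
have C0 : 0 <= C by apply: le_trans (AC ord0); apply: sumr_ge0.
elim: m i => [|m IH] i.
  rewrite expr0 (bigD1 i) //= mxE eqxx normr1 big1 ?addr0 // => j ji.
  by rewrite mxE eq_sym (negbTE ji) normr0.
rewrite exprS.
apply: (@le_trans _ _ (\sum_j \sum_l `|A i l| * `|(A ^+ m) l j|)).
  apply: ler_sum => j _; rewrite mxE; apply: (le_trans (ler_norm_sum _ _ _)).
  by apply: ler_sum => l _; rewrite normrM.
rewrite exchange_big /= exprS.
apply: (@le_trans _ _ (\sum_l `|A i l| * C ^+ m)).
  by apply: ler_sum => l _; rewrite -mulr_sumr ler_wpM2l.
by rewrite -mulr_suml ler_wpM2r // exprn_ge0.
Qed.

Lemma entry_exp_le m i j : `|(A ^+ m) i j| <= C ^+ m.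
Proof.
by apply: le_trans (row_sum_exp m i); rewrite (bigD1 j) //= lerDl sumr_ge0.
Qed.

(** Eigenvectors are row vectors here, so row sums pair with the l^1 norm: summing [|x v_j|] over j
    gives at most C times the l^1 norm of v. *)
Lemma eigenvalue_row_sum x : eigenvalue A x -> `|x| <= C.
Proof.
move=> /eigenvalueP[v vA v0].
have vs : 0 < \sum_j `|v ord0 j|.
  rewrite lt_neqAle sumr_ge0 // andbT eq_sym; apply: contraNneq v0 => s0.
  apply/eqP/rowP => j; rewrite mxE; apply/eqP; rewrite -normr_eq0.
  by rewrite (psumr_eq0P _ s0).
rewrite -(ler_pM2r vs) mulr_sumr.
apply: (@le_trans _ _ (\sum_j \sum_i `|v ord0 i| * `|A i j|)).
  apply: ler_sum => j _; rewrite -normrM.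
  have -> : x * v ord0 j = (v *m A) ord0 j by rewrite vA mxE.
  rewrite mxE; apply: (le_trans (ler_norm_sum _ _ _)).
  by apply: ler_sum => i _; rewrite normrM.
rewrite exchange_big /= mulr_sumr; apply: ler_sum => i _.
by rewrite -mulr_sumr mulrC ler_wpM2r.
Qed.

End row_sums.

Section spectral_bound.
Variables (R : realType) (k : nat) (Q : nat -> {poly Cx R}).
Hypothesis hQ : high_order_heun k Q.

(** For [i <= n] and [l <= k] one has i ^_ l <= n^k once n > 0, and n^k / lambda_n converges, hence
    is bounded. *)
Lemma near_heun_entry_bounded : exists C : Cx R,
  \forall n \near \oo, forall i r, (i <= n)%N -> (r < k.+2)%N ->
    `|heun_entry k Q n i r| <= C.
Proof.
have [k0 _ _] := hQ.
have [D hD] : exists D : Cx R, \forall n \near \oo, `|n%:R ^+ k / heun_lambda k Q n| <= D.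
  exists (`|((Q k)`_k.+1)^-1| + 1).
  have /cvgrPdist_lt/(_ 1 ltr01) := cvg_heun_lambdaV hQ.
  apply: filterS => n h; rewrite -[X in `|X|](subKr ((Q k)`_k.+1)^-1).
  by apply: (le_trans (ler_normB _ _)); rewrite lerD2l ltW.
pose B : Cx R := \sum_(r < k.+2) \sum_(1 <= l < k.+1 | (r <= l.+1)%N) `|(Q l)`_(l.+1 - r)|.
exists (1 + D * B); near=> n => i r le_in rk.
have n0 : (0 < n)%N by near: n; exact: nbhs_infty_gt.
have hDn : `|n%:R ^+ k / heun_lambda k Q n| <= D by near: n.
have D0 : 0 <= D by apply: le_trans hDn.
rewrite /heun_entry; apply: (le_trans (ler_normB _ _)); apply: lerD.
  by rewrite normr_nat lern1 leq_b1.
apply: (@le_trans _ _ (`|n%:R ^+ k / heun_lambda k Q n| *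
   \sum_(1 <= l < k.+1 | (r <= l.+1)%N) `|(Q l)`_(l.+1 - r)|)).
  rewrite normrM mulrC normrM [`|n%:R ^+ k| * _]mulrC -mulrA.
  rewrite [X in X <= _]mulrC ler_wpM2l //.
  apply: (le_trans (ler_norm_sum _ _ _)).
  rewrite mulr_sumr big_seq_cond [X in _ <= X]big_seq_cond.
  apply: ler_sum => l /andP[]; rewrite mem_index_iota => /andP[_ lk] _.
  rewrite normrM mulrC ler_wpM2r // normr_nat normrX normr_nat -natrX ler_nat.
  apply: (@leq_trans (n ^ l)); last by rewrite leq_pexp2l.
  apply: (@leq_trans (i ^ l)); last by case: (l) => // l'; rewrite leq_exp2r.
  by elim: (l) => // l' IH; rewrite ffactnSr expnSr leq_mul // leq_subr.
apply: ler_pM => //; first by apply: sumr_ge0.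
rewrite /B (bigD1 (Ordinal rk)) //= lerDl; apply: sumr_ge0 => j _.
by apply: sumr_ge0.
Unshelve. all: by end_near. Qed.

(** Each of the k + 2 values of r contributes to at most one column, namely i + 1 - r, and to none
    when this equals n + 1. *)
Lemma near_spectral_mx_row_sum : exists C : Cx R,
  \forall n \near \oo, forall i, \sum_j `|spectral_mx k Q n i j| <= C.
Proof.
have [k0 sQ _] := hQ; have [C hC] := near_heun_entry_bounded.
exists (\sum_(r < k.+2) C); near=> n => i.
have hCn : forall i r, (i <= n)%N -> (r < k.+2)%N -> `|heun_entry k Q n i r| <= C by near: n.
have l0 : heun_lambda k Q n != 0 by near: n; exact: near_heun_lambda_neq0.
apply: (@le_trans _ _ (\sum_j \sum_(r < k.+2) `|heun_entry k Q n i r| *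
   (nat_of_ord j == i.+1 - r)%N%:R)).
  apply: ler_sum => j _; rewrite -[spectral_mx _ _ _]expr1 spectral_mx_expE //=.
  rewrite spectral_opXn // coef_sum; apply: (le_trans (ler_norm_sum _ _ _)).
  by apply: ler_sum => r _; rewrite coefZ coefXn normrM normr_nat.
rewrite exchange_big; apply: ler_sum => r _; rewrite -mulr_sumr.
apply: (@le_trans _ _ (`|heun_entry k Q n i r| * 1)); last first.
  by rewrite mulr1 hCn // -ltnS.
rewrite ler_wpM2l //; have [ir|ir] := ltnP (i.+1 - r) n.+1.
  rewrite (bigD1 (Ordinal ir)) //= eqxx big1 ?addr0 // => j /negbTE.
  by rewrite -val_eqE /= => ->.
by rewrite big1 // => j _; rewrite ltn_eqF // (leq_trans (ltn_ord j)).
Unshelve. all: by end_near. Qed.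

End spectral_bound.

(** * Means as integrals *)

Section step_function.
Variable R : realType.
Implicit Types (h : nat -> R) (n : nat) (t : R).

Let cell n i : set R := `[i%:R / n.+1%:R, i.+1%:R / n.+1%:R[%classic.

Definition step_fun h n t : R := \sum_(i < n.+1) h i * \1_(cell n i) t.

(** The half-open cells partition [0, 1[, and the one containing t has index floor((n + 1) t); the
    point 1 lies in no cell. *)
Lemma step_funE h n t : 0 <= t < 1 ->
  (Num.truncn (n.+1%:R * t) <= n)%N /\ step_fun h n t = h (Num.truncn (n.+1%:R * t)).
Proof.
move=> /andP[t0 t1]; have n0 : 0 < n.+1%:R :> R by rewrite ltr0n.
have nt0 : 0 <= n.+1%:R * t by rewrite mulr_ge0.
have le_n : (Num.truncn (n.+1%:R * t) < n.+1)%N.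
  by rewrite truncn_lt_nat // gtr_pMr.
split; first by rewrite -ltnS.
have cellE i : (t \in cell n i) = (Num.truncn (n.+1%:R * t) == i).
  rewrite truncn_eq //; apply/idP/idP; rewrite inE /cell /= in_itv /=.
    by rewrite ler_pdivrMr // ltr_pdivlMr // mulrC.
  by rewrite ler_pdivrMr // ltr_pdivlMr // mulrC.
rewrite /step_fun (bigD1 (Ordinal le_n)) //= indicE cellE eqxx mulr1.
rewrite big1 ?addr0 // => i; rewrite indicE cellE -val_eqE /= eq_sym => /negbTE ->.
by rewrite mulr0.
Qed.

Lemma measurable_step_fun D h n : measurable_fun D (step_fun h n).
Proof.
apply: measurable_sum => i; apply: measurable_funM; first exact: measurable_cst.
by apply: measurable_indic; exact: measurable_itv.
Qed.

Lemma integral_step_fun h n :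
  (\int[lebesgue_measure]_(t in `[0%R, 1%R]) (step_fun h n t)%:E
    = (n.+1%:R^-1 * \sum_(i < n.+1) h i)%:E)%E.
Proof.
have n0 : 0 < n.+1%:R :> R by rewrite ltr0n.
have ic i : lebesgue_measure.-integrable `[0%R, 1%R] (fun x => (\1_(cell n i) x)%:E).
  by apply: (@integrableS _ _ _ _ setT) => //; exact: integrable_indic_itv.
under eq_integral do rewrite -sumEFin.
rewrite integral_sum //=; last first.
  by move=> i; apply: (integrableZl _ (h i) (ic i)).
rewrite mulr_sumr -sumEFin; apply: eq_bigr => i _.
under eq_integral do rewrite EFinM.
rewrite integralZl //.
rewrite integral_indic //; last exact: measurable_itv.
rewrite setIidl; last first.
  move=> t; rewrite /cell /= !in_itv /= => /andP[a b]; apply/andP; split.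
    by apply: le_trans a; rewrite divr_ge0.
  by apply/ltW/(lt_le_trans b); rewrite ler_pdivrMr // mul1r ler_nat.
rewrite /= lebesgue_measure_itv /= lte_fin ltr_pM2r ?invr_gt0 // ltr_nat leqnn.
by rewrite -EFinB -mulrBl -natrB // subSnn mul1r -EFinM mulrC.
Qed.

Lemma cvg_mean_Rintegral (h : nat -> nat -> R) (g : R -> R) (B : R) :
  (forall n i, (i <= n)%N -> `|h n i| <= B) ->
  (forall t (s : nat -> nat), 0 < t < 1 -> (s n)%:R / n%:R @[n --> \oo] --> t ->
     h n (s n) @[n --> \oo] --> g t) ->
  n.+1%:R^-1 * \sum_(i < n.+1) h n i @[n --> \oo] -->
    \int[lebesgue_measure]_(t in `[0, 1]) g t.
Proof.
move=> hB hg.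
have D01 t : `]0%R, 1%R[%classic t -> 0 < t < 1 by rewrite /= in_itv.
have fcvg t : `]0%R, 1%R[%classic t -> step_fun (h n) n t @[n --> \oo] --> g t.
  move=> /D01 /[dup] t01 /andP[t0 t1].
  pose s n := Num.truncn (n.+1%:R * t).
  have -> : (fun n => step_fun (h n) n t) = (fun n => h n (s n)).
    by apply/funext => n; rewrite (step_funE _ _ _).2 // t1 ltW.
  apply: hg => //.
  (* From (n + 1) t - 1 < s n <= (n + 1) t, divided by n. *)
  apply: (@squeeze_cvgr _ \oo _ R (fun n => t - n%:R^-1)
     (fun n => t + t * n%:R^-1)).
  - near=> n; have n0 : 0 < n%:R :> R by rewrite ltr0n; near: n; exact: nbhs_infty_gt.
    have nt0 : 0 <= n.+1%:R * t by rewrite mulr_ge0 // ltW.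
    have /andP[a b] := truncn_itv nt0; rewrite -/(s n) in a b.
    have e1 : t - n%:R^-1 = (n%:R * t - 1) / n%:R by field; rewrite lt0r_neq0.
    have e2 : t + t * n%:R^-1 = (n.+1%:R * t) / n%:R.
      by rewrite -natr1; field; rewrite lt0r_neq0.
    rewrite e1 e2 !ler_pM2r ?invr_gt0 // a andbT.
    rewrite -natr1 in b; rewrite -natr1 mulrDl mul1r in b.
    by lra.
  - rewrite -[X in _ --> X]subr0; apply: cvgB; [exact: cvg_cst|exact: cvg_inv_nat].
  - rewrite -[X in _ --> X]addr0 -[X in _ + X](mulr0 t); apply: cvgD; first exact: cvg_cst.
    by apply: cvgM; [exact: cvg_cst|exact: cvg_inv_nat].
(* Measurability of g is not assumed: it comes from the pointwise limit of step functions on the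
   open interval, which differs from [0, 1] by a null set. *)
have mg : measurable_fun (`]0%R, 1%R[%classic : set R) g.
  apply: (measurable_fun_cvg (h := fun n => step_fun (h n) n)) => // n.
  exact: measurable_step_fun.
have [] := @dominated_convergence _ _ R lebesgue_measure `]0%R, 1%R[%classic _
  (fun n t => (step_fun (h n) n t)%:E) (fun t => (g t)%:E) (fun=> B%:E) _ _ _ _ _ => //.
- by move=> n; apply/measurable_EFinP; exact: measurable_step_fun.
- exact/measurable_EFinP.
- by apply: aeW => t Dt; apply: cvg_EFin; [exact: nearW|exact: fcvg].
- apply: measurable_bounded_integrable => //.
    by rewrite /= lebesgue_measure_itv /= lte_fin ltr01 oppr0 adde0 ltry.
  by exists `|B|; split; [exact: num_real|by move=> M /ltW BM t _].
- apply: aeW => t n /D01 /andP[t0 t1]; rewrite lee_fin.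
  have [|le_n ->] := @step_funE (h n) n t; first by rewrite t1 ltW.
  exact: hB.
move=> ig _ cvi; rewrite /Rintegral.
rewrite integral_itv_bndoo; last exact/measurable_EFinP.
apply: (@cvg_near_eq nat R \oo _
   (fun n => fine (\int[lebesgue_measure]_(t in `]0%R, 1%R[) (step_fun (h n) n t)%:E)%E)).
  apply: nearW => n /=; have := integral_step_fun (h n) n.
  rewrite integral_itv_bndoo; last by apply/measurable_EFinP; exact: measurable_step_fun.
  by move=> ->.
apply: fine_cvg; rewrite fineK //; exact: integrable_fin_num.
Unshelve. all: by end_near. Qed.

End step_function.

(** * Van Vleck roots and their moments *)

Lemma cvg_mean_Cintegral (R : realType) (h : nat -> nat -> Cx R) (g : R -> Cx R)
    (B : Cx R) :
  (\forall n \near \oo, forall i, (i <= n)%N -> `|h n i| <= B) ->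
  (forall (t : R) (s : nat -> nat), 0 < t < 1 -> (s n)%:R / n%:R @[n --> \oo] --> t ->
     h n (s n) @[n --> \oo] --> g t) ->
  n.+1%:R^-1 * \sum_(i < n.+1) h n i @[n --> \oo] -->
    Cintegral (@lebesgue_measure R) `[0, 1] g.
Proof.
move=> [N _ hB] hg.
(* [cvg_mean_Rintegral] wants a bound at every n; setting the values before rank N to 0 provides it
   without changing the limits. *)
pose h' n i := if (N <= n)%N then h n i else 0.
have nearN : \forall n \near \oo, (N <= n)%N by exists N.
have hB' n i : (i <= n)%N -> `|h' n i| <= `|B|.
  move=> le_in; rewrite /h'; case: ifP => [Nn|_]; last by rewrite normr0.
  by have hn := hB n Nn i le_in; rewrite (ger0_norm (le_trans _ hn)).

have [b Bb] : exists b : R, `|B| = real_complex R b.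
  by exists (complex.Re `|B|); rewrite RRe_real // normr_real.
have hg' (t : R) (s : nat -> nat) : 0 < t < 1 -> (s n)%:R / n%:R @[n --> \oo] --> t ->
     h' n (s n) @[n --> \oo] --> g t.
  move=> t01 st; apply: (@cvg_near_eq nat (Cx R) \oo _ (fun n => h n (s n))); last exact: hg.
  by apply: filterS nearN => n Nn; rewrite /h' Nn.
apply: (@cvg_near_eq nat (Cx R) \oo _ (fun n => n.+1%:R^-1 * \sum_(i < n.+1) h' n i)).
  by apply: filterS nearN => n Nn; congr (_ * _); apply: eq_bigr => i _; rewrite /h' Nn.
have ReIm n : n.+1%:R^-1 * \sum_(i < n.+1) h' n i =
   Complex (n.+1%:R^-1 * \sum_(i < n.+1) complex.Re (h' n i))
     (n.+1%:R^-1 * \sum_(i < n.+1) complex.Im (h' n i)).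
  have -> : (n.+1%:R^-1 : Cx R) = real_complex R n.+1%:R^-1.
    by rewrite fmorphV /= real_complex_nat.
  have -> : \sum_(i < n.+1) h' n i = Complex (\sum_(i < n.+1) complex.Re (h' n i))
     (\sum_(i < n.+1) complex.Im (h' n i)).
    elim: n.+1 => [|p IH]; first by rewrite !big_ord0.
    by rewrite !big_ord_recr /= IH; case: (h' n p).
  by rewrite /GRing.mul /= !mul0r subr0 addr0.
under eq_fun do rewrite ReIm.
apply: cvg_complex => /=.
  apply: (@cvg_mean_Rintegral R (fun n i => complex.Re (h' n i)) _ b) => [n i le_in|t s t01 st].
    by rewrite -lecR -Bb; apply: le_trans (hB' n i le_in); exact: normc_ge_Re.
  by apply: cvg_complex_Re; exact: hg'.
apply: (@cvg_mean_Rintegral R (fun n i => complex.Im (h' n i)) _ b) => [n i le_in|t s t01 st].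
  by rewrite -lecR -Bb; apply: le_trans (hB' n i le_in); exact: normc_ge_Im.
by apply: cvg_complex_Im; exact: hg'.
Qed.

Section van_vleck.
Variables (R : realType) (k : nat) (Q : nat -> {poly Cx R}).
Hypothesis hQ : high_order_heun k Q.

(** The operator raises degrees by at most one, so only the leading monomial reaches this
    coefficient. For S = 0 both sides are 0. *)
Lemma coef_size_spectral_op n (S : {poly Cx R}) :
  (spectral_op k Q n S)`_(size S) = lead_coef S * heun_entry k Q n (size S).-1 0.
Proof.
have [k0 sQ _] := hQ; rewrite spectral_op_sum coef_sum lead_coefE.
case sS : (size S) => [|j] /=.
  by rewrite big_ord0 nth_default ?sS // mul0r.
rewrite big_ord_recr /= big1 ?add0r => [|i _].
  rewrite coefZ spectral_opXn // coef_sum big_ord_recl /=.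
  rewrite coefZ subn0 coefXn eqxx mulr1 big1 ?addr0 // => r _.
  by rewrite coefZ coefXn gtn_eqF ?mulr0 // /bump; lia.
rewrite coefZ [X in _ * X]nth_default ?mulr0 //.
apply: (leq_trans (size_spectral_op n sQ (leqnn _))).
by rewrite size_polyXn ltnS; exact: ltn_ord.
Qed.

Lemma eigenvalue_van_vleck n x :
  heun_lambda k Q n != 0 ->
  (forall j, (j < n)%N -> heun_lambda k Q n != heun_lambda k Q j) ->
  eigenvalue (spectral_mx k Q n) x ->
  van_vleck k Q n (- heun_lambda k Q n *: ('X - x%:P)).
Proof.
move=> l0 linj /eigenvalueP[v vM v0]; have [k0 sQ _] := hQ.
split.
  by apply: (leq_trans (size_scale_leq _ _)); rewrite size_XsubC.
exists (rVpoly v); set S := rVpoly v.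
have S0 : S != 0.
  by apply: contra_neq v0 => S0; rewrite -[v]rVpolyK -/S S0 linear0.
have TS : spectral_op k Q n S = x *: S.
  by rewrite /S -mul_spectral_mx // vM linearZ.
have sS : (size S <= n.+1)%N by exact: size_poly.
split.
  (* If S had degree j < n, the coefficient of z^(j+1), zero in [x *: S], would be the leading
     coefficient of S times 1 - lambda_j / lambda_n, forcing lambda_j = lambda_n. *)
  apply/eqP; rewrite eqn_leq sS /= ltnNge; apply/negP => sSn.
  have := coef_size_spectral_op n S.
  rewrite TS coefZ nth_default ?leqnn // mulr0 => /esym/eqP.
  rewrite mulf_eq0 lead_coef_eq0 (negbTE S0) /= /heun_entry /= subr_eq0.
  rewrite -[X in _ * X]/(heun_lambda k Q (size S).-1) => /eqP e.
  have jn : ((size S).-1 < n)%N by rewrite prednK // size_poly_gt0.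
  by move/eqP: (linj _ jn); apply; apply: (mulfI (invr_neq0 l0)); rewrite -e mulVf.
move/eqP: TS; rewrite /spectral_op subr_eq addrC -subr_eq => /eqP.
move=> /(congr1 (fun p => heun_lambda k Q n *: p)).
rewrite scalerA mulfV // scale1r => <-.
rewrite scalerBr -scalerAl mulrBl mul_polyC scaleNr scalerBr opprB.
by rewrite addrA subrK subrr.
Qed.

(** For n large the filter in [van_vleck_roots] discards nothing, so all eigenvalues remain with
    their algebraic multiplicities and traces compute the power sums. *)
Lemma spectral_polyE : \forall n \near \oo, spectral_poly k Q n = char_poly (spectral_mx k Q n).
Proof.
near=> n; rewrite /spectral_poly /van_vleck_roots.
have l0 : heun_lambda k Q n != 0 by near: n; exact: near_heun_lambda_neq0.
have linj : forall j, (j < n)%N -> heun_lambda k Q n != heun_lambda k Q j.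
  by near: n; exact: near_heun_lambda_inj.
rewrite (_ : seq.filter _ _ = zeros (char_poly (spectral_mx k Q n))).
  by rewrite zeros_prod // char_poly_monic.
apply/all_filterP/allP => x xz; apply/asboolP; apply: eigenvalue_van_vleck => //.
rewrite eigenvalue_root_char -(zeros_prod (char_poly_monic _)).
by rewrite root_prod_XsubC.
Unshelve. all: by end_near. Qed.

Lemma near_size_zeros_spectral_poly :
  \forall n \near \oo, size (zeros (spectral_poly k Q n)) = n.+1.
Proof.
apply: filterS spectral_polyE => n ->.
by rewrite size_zeros ?char_poly_monic // size_char_poly.
Qed.

Lemma near_mean_power m : \forall n \near \oo,
  mean_power k Q m n = n.+1%:R^-1 * \tr (spectral_mx k Q n ^+ m).
Proof.
by apply: filterS spectral_polyE => n; rewrite /mean_power => ->; rewrite sum_zeros_char_poly.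
Qed.

Lemma near_zeros_bounded : exists C : Cx R, \forall n \near \oo,
  forall x, x \in zeros (spectral_poly k Q n) -> `|x| <= C.
Proof.
have [C hC] := near_spectral_mx_row_sum hQ; exists C.
near=> n => x; have -> : spectral_poly k Q n = char_poly (spectral_mx k Q n).
  by near: n; exact: spectral_polyE.
move=> xz; apply: (eigenvalue_row_sum (A := spectral_mx k Q n)); first by near: n.
rewrite eigenvalue_root_char -(zeros_prod (char_poly_monic _)).
by rewrite root_prod_XsubC.
Unshelve. all: by end_near. Qed.

Lemma cvg_mean_power m : Q k \is monic -> root (Q k) 0 ->
  mean_power k Q m n @[n --> \oo] --> heun_moment k (Q k) m.
Proof.
move=> mQ rQ; have [k0 sQ sk] := hQ.
have Q1 : (Q k)`_k.+1 = 1.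
  by move/monicP: mQ; rewrite lead_coefE sk.
have Q0 : (Q k)`_0 = 0 by rewrite -horner_coef0; exact/rootP.
apply: (@cvg_near_eq nat (Cx R) \oo _ (fun n => n.+1%:R^-1 *
   \sum_(i < n.+1) (iter m (spectral_op k Q n) 'X^i)`_i)).
  near=> n.
  have -> : mean_power k Q m n = n.+1%:R^-1 * \tr (spectral_mx k Q n ^+ m).
    by near: n; exact: near_mean_power.
  congr (_ * _); apply: eq_bigr => i _; rewrite spectral_mx_expE //.
  by near: n; exact: near_heun_lambda_neq0.
have [C hC] := near_spectral_mx_row_sum hQ.
have -> : heun_moment k (Q k) m = Cintegral (@lebesgue_measure R) `[0, 1]
    (fun t => (symbol_poly k (Q k) t ^+ m)`_m).
  by congr Cintegral; apply/funext => t; rewrite constant_term_heun_symbol.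
apply: (@cvg_mean_Cintegral _ (fun n i => (iter m (spectral_op k Q n) 'X^i)`_i) _ (C ^+ m)).
  near=> n => i le_in; pose j := Ordinal (le_in : (i < n.+1)%N).
  have l0 : heun_lambda k Q n != 0 by near: n; exact: near_heun_lambda_neq0.
  have -> : (iter m (spectral_op k Q n) 'X^i)`_i = (spectral_mx k Q n ^+ m) j j.
    by rewrite spectral_mx_expE.
  by apply: entry_exp_le; near: n.
move=> t s /andP[t0 _] st.
(* The diagonal entry is the case [p = m]: the constant term of the m-th power of the symbol is the
   coefficient of w^m in G_t^m. *)
apply: (@cvg_near_eq nat (Cx R) \oo _
  (fun n => (iter m (spectral_op k Q n) 'X^(s n))`_(s n + m - m))).
  by apply: nearW => n; rewrite addnK.
exact: (@cvg_iter_spectral_op R k Q hQ Q1 t m m s t0 st).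
Unshelve. all: by end_near. Qed.

End van_vleck.

(** * Affine changes of variable *)

Section affine.
Variables (R : realType) (k : nat) (Q : nat -> {poly Cx R}) (a b : Cx R).
Hypotheses (hQ : high_order_heun k Q) (a0 : a != 0) (rb : root (Q k) b).

Let phi : {poly Cx R} := a *: 'X + b%:P.

Lemma size_affine : size phi = 2.
Proof.
rewrite /phi size_polyDl size_scale // size_polyX //.
by rewrite (leq_ltn_trans (size_polyC_leq1 _)).
Qed.

Lemma size_affine_sub p : size (affine_sub a b p) = size p.
Proof. by rewrite size_comp_poly2 // size_affine. Qed.

Lemma lead_coef_affine : lead_coef phi = a.
Proof.
rewrite lead_coefE size_affine /= /phi coefD coefZ coefX coefC mulr1.
by rewrite addr0.
Qed.

(** Only a coefficient at or above the degree simply scales. Degree below l is allowed, both sides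
    then being 0, as for a Q_i of degree less than i + 1. *)
Lemma coef_affine_sub (p : {poly Cx R}) l :
  (size p <= l.+1)%N -> (affine_sub a b p)`_l = p`_l * a ^+ l.
Proof.
rewrite leq_eqVlt => /orP[/eqP sp|sp]; last first.
  by rewrite !nth_default ?mul0r // size_affine_sub.
have := lead_coef_comp p (q := phi); rewrite size_affine lead_coef_affine => /(_ isT).
by rewrite !lead_coefE -/(affine_sub a b p) size_affine_sub sp.
Qed.

Lemma derivn_affine_sub p i :
  (affine_sub a b p)^`(i) = a ^+ i *: affine_sub a b p^`(i).
Proof.
elim: i => [|i IH]; first by rewrite expr0 scale1r.
rewrite !derivnS IH derivZ deriv_comp derivD derivZ derivX derivC addr0.
by rewrite -/(affine_sub a b _) alg_polyC mulrC mul_polyC scalerA -exprSr.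
Qed.

Lemma affine_subM p q : affine_sub a b (p * q) = affine_sub a b p * affine_sub a b q.
Proof. exact: comp_polyM. Qed.

(* The factor makes heun_affine k monic and divides the eigenvalue parameter
   heun_lambda by lead_coef (Q k). *)
Definition heun_affine (i : nat) : {poly Cx R} :=
  (lead_coef (Q k) * a * a ^+ i)^-1 *: affine_sub a b (Q i).

Let q := lead_coef (Q k).

Lemma heun_lead_coef_neq0 : q != 0.
Proof.
by have [_ _ sk] := hQ; rewrite lead_coef_eq0 -size_poly_gt0 sk.
Qed.

Lemma heun_affine_lead : heun_affine k = monic_multiple (affine_sub a b (Q k)).
Proof.
have [_ _ sk] := hQ; rewrite /heun_affine /monic_multiple; congr (_^-1 *: _).
rewrite [RHS]lead_coef_comp ?size_affine // lead_coef_affine sk /= exprS.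
by rewrite mulrA.
Qed.

Lemma high_order_heun_affine : high_order_heun k heun_affine.
Proof.
have [k0 sQ sk] := hQ; have q0 := heun_lead_coef_neq0; split=> // [i ik|].
  by apply: (leq_trans (size_scale_leq _ _)); rewrite size_affine_sub sQ.
by rewrite size_scale ?size_affine_sub // invr_eq0 !mulf_neq0 // expf_neq0.
Qed.

Lemma heun_affine_monic : heun_affine k \is monic.
Proof.
rewrite heun_affine_lead /monic_multiple monicE lead_coefZ mulVf //.
have [_ _ sk] := hQ.
by rewrite lead_coef_eq0 -size_poly_gt0 size_affine_sub sk.
Qed.

Lemma heun_affine_root : root (heun_affine k) 0.
Proof.
rewrite /root hornerZ /affine_sub horner_comp hornerD hornerZ hornerX hornerC.
by rewrite mulr0 add0r (rootP rb) mulr0.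
Qed.

(** By the chain rule the i-th derivative in u brings out a^i, which the factor in [heun_affine]
    cancels. *)
Lemma heun_op_affine S :
  heun_op k heun_affine (affine_sub a b S) = (q * a)^-1 *: affine_sub a b (heun_op k Q S).
Proof.
rewrite /heun_op /affine_sub [in RHS]rmorph_sum scaler_sumr; apply: eq_bigr => i _ /=.
rewrite -/(affine_sub a b S) derivn_affine_sub /heun_affine -scalerAl -scalerAr scalerA.
rewrite -/(affine_sub a b (Q i * _)) affine_subM; congr (_ *: _).
by rewrite -/q invfM mulfVK // expf_neq0.
Qed.

(** The coefficient of degree l + 1 is scaled by a^(l+1), which cancels a * a^l in [heun_affine]. *)
Lemma heun_lambda_affine n : heun_lambda k heun_affine n = q^-1 * heun_lambda k Q n.
Proof.
have [k0 sQ sk] := hQ.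
rewrite /heun_lambda mulr_sumr big_nat [RHS]big_nat; apply: eq_bigr => l lk.
rewrite /heun_affine coefZ coef_affine_sub ?sQ // [RHS]mulrA; congr (_ * _).
rewrite exprS -/q !invfM; have h := expf_neq0 l a0; field.
by rewrite h a0 heun_lead_coef_neq0.
Qed.

(** Multiplication by z becomes multiplication by a u + b, while the operator divided by its lambda
    is multiplied by 1 / a, the factors q cancelling. *)
Lemma spectral_op_affine n S :
  affine_sub a b (spectral_op k Q n S) =
    a *: spectral_op k heun_affine n (affine_sub a b S) + b *: affine_sub a b S.
Proof.
rewrite /spectral_op heun_op_affine heun_lambda_affine scalerBr !scalerA.
rewrite {1}/affine_sub comp_polyB comp_polyM comp_polyX comp_polyZ -/(affine_sub a b S).
rewrite mulrDl -scalerAl mul_polyC [RHS]addrAC; congr (_ + _ - _ *: _).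
rewrite !invfM invrK; move: (heun_lambda k Q n)^-1 => li; field.
by rewrite a0 heun_lead_coef_neq0.
Qed.

Definition affine_mx n : 'M[Cx R]_n.+1 :=
  lin1_mx (fun v : 'rV_n.+1 => poly_rV (affine_sub a b (rVpoly v))).

Lemma mul_affine_mx n (v : 'rV_n.+1) :
  rVpoly (v *m affine_mx n) = affine_sub a b (rVpoly v).
Proof.
rewrite mul_rV_linear1; first by rewrite poly_rV_K // size_affine_sub size_poly.
by move=> c u w; rewrite [rVpoly _]linearP /affine_sub comp_polyD comp_polyZ linearP.
Qed.

(** Composition with a polynomial of degree one preserves [size], so the kernel is zero. *)
Lemma affine_mx_unit n : affine_mx n \in unitmx.
Proof.
rewrite -row_free_unit -kermx_eq0; apply/rowV0P => v /sub_kermxP vP.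
apply: (can_inj rVpolyK); rewrite linear0; apply/eqP.
by rewrite -size_poly_eq0 -size_affine_sub -mul_affine_mx vP linear0 size_poly0.
Qed.

Lemma spectral_mx_affine n : heun_lambda k Q n != 0 ->
  spectral_mx k Q n *m affine_mx n =
    affine_mx n *m (a *: spectral_mx k heun_affine n + b%:M).
Proof.
move=> l0; have [k0 sQ sk] := hQ; have [_ sQ' _] := high_order_heun_affine.
have l0' : heun_lambda k heun_affine n != 0.
  by rewrite heun_lambda_affine mulf_neq0 // invr_eq0 heun_lead_coef_neq0.
apply/row_matrixP => i; rewrite !rowE; set v := delta_mx 0 i.
apply: (can_inj rVpolyK); rewrite !mulmxA mul_affine_mx mul_spectral_mx //.
rewrite spectral_op_affine mulmxDr -scalemxAr mul_mx_scalar linearP /=.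
rewrite mul_spectral_mx // mul_affine_mx; congr (_ + _).
by rewrite linearZ /= mul_affine_mx.
Qed.

Lemma mxtrace_spectral_mx_affine n m : heun_lambda k Q n != 0 ->
  \tr (spectral_mx k Q n ^+ m) = \sum_(j < m.+1) 'C(m, j)%:R * a ^+ j * b ^+ (m - j)
     * \tr (spectral_mx k heun_affine n ^+ j).
Proof.
move=> l0; set M' := spectral_mx k heun_affine n.
have uP := affine_mx_unit n.
have -> : spectral_mx k Q n = affine_mx n *m (a *: M' + b%:M) *m invmx (affine_mx n).
  by rewrite -spectral_mx_affine // mulmxK.
rewrite exp_conjmx // mxtrace_conj // addrC -scalemx1 exprDn_comm; last first.
  by rewrite /GRing.comm -!scalerAl -!scalerAr mul1r mulr1 !scalerA mulrC.
rewrite raddf_sum; apply: eq_bigr => j _ /=.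
rewrite !exprZn expr1n -scalerAl mul1r scalerA -scaler_nat !linearZ /= !mulrA.
by congr (_ * _); rewrite -mulrA [b ^+ _ * _]mulrC mulrA.
Qed.

Lemma cvg_mean_power_affine m :
  mean_power k Q m n @[n --> \oo] --> affine_moment k (Q k) a b m.
Proof.
have hQ' := high_order_heun_affine.
apply: (@cvg_near_eq nat (Cx R) \oo _ (fun n => \sum_(j < m.+1) 'C(m, j)%:R * a ^+ j * b ^+ (m - j)
     * mean_power k heun_affine j n)).
  near=> n.
  have -> : mean_power k Q m n = n.+1%:R^-1 * \tr (spectral_mx k Q n ^+ m).
    by near: n; exact: near_mean_power.
  rewrite mxtrace_spectral_mx_affine; last by near: n; exact: near_heun_lambda_neq0.
  (* This identity holds from a rank independent of j, hence serves all terms of the binomial sum at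
     once. *)
  have e : spectral_poly k heun_affine n = char_poly (spectral_mx k heun_affine n).
    by near: n; exact: spectral_polyE.
  rewrite mulr_sumr; apply: eq_bigr => j _; rewrite [RHS]mulrCA; congr (_ * _).
  by rewrite /mean_power e sum_zeros_char_poly.
apply: cvg_bigsum => j _ _; apply: cvgM; first exact: cvg_cst.
rewrite -heun_affine_lead; apply: cvg_mean_power => //.
  exact: heun_affine_monic.
exact: heun_affine_root.
Unshelve. all: by end_near. Qed.

End affine.

(** * Weak limits *)

Section weak_limits.
Variable R : realType.

Lemma measurable_continuous (f : Cx R -> R) :
  continuous f -> measurable_fun setT (f : borelC R -> R).
Proof.
move=> cf; apply: (measurability (RGenOInfty.G (R := R))).
  exact: RGenOInfty.measurableE.
move=> _ [_ [x ->] <-]; rewrite setTI; apply: sub_sigma_algebra.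
apply: open_comp; first by move=> z _; exact: cf.
by rewrite set_itvE; exact: open_gt.
Qed.

Lemma continuous_exprC m : continuous (fun z : Cx R => z ^+ m).
Proof.
elim: m => [|m IH] z.
  rewrite (_ : (fun x : Cx R => x ^+ 0) = cst 1); first exact: cst_continuous.
  by apply/funext => x; rewrite expr0.
rewrite (_ : (fun x : Cx R => x ^+ m.+1) = fun x => x * x ^+ m).
  apply: (@cvgM (Cx R) (Cx R) (nbhs z) _ id (fun x => x ^+ m) z (z ^+ m)).
    exact: cvg_id.
  exact: IH.
by apply/funext => x; rewrite exprS.
Qed.

(** The norm of [Cx R] takes its values in [Cx R]; real test functions need a real modulus. *)
Definition modulus (z : Cx R) : R := complex.Re `|z|.

Lemma modulusE z : `|z| = real_complex R (modulus z).
Proof. by rewrite /modulus RRe_real // normr_real. Qed.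

Lemma continuous_modulus : continuous modulus.
Proof.
move=> z; apply: (@cvg_complex_Re R (Cx R) (nbhs z) _ (fun x => `|x|) `|z|).
exact: norm_continuous.
Qed.

Variables (k : nat) (Q : nat -> {poly Cx R}).
Hypothesis hQ : high_order_heun k Q.
Local Notation zs n := (zeros (spectral_poly k Q n)).

Lemma integral_root_counting_measure n (f : Cx R -> R) :
  continuous f -> (forall z, 0 <= f z) ->
  (\int[root_counting_measure k Q n]_x (f x)%:E
    = (n.+1%:R^-1 * \sum_(x <- zs n) f x)%:E)%E.
Proof.
move=> cf f0; have mf := measurable_continuous cf.
have mf' : measurable_fun setT (fun x : borelC R => (f x)%:E) by exact/measurable_EFinP.
have f0' (x : borelC R) : setT x -> (0 <= (f x)%:E)%E by rewrite lee_fin.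
rewrite /root_counting_measure ge0_integral_mscale //.
rewrite ge0_integral_measure_sum //.
rewrite EFinM; congr (_ * _)%E; rewrite (big_nth 0) big_mkord -sumEFin.
by apply: eq_bigr => i _; rewrite integral_dirac // diracT mul1e.
Qed.

Variable mu : {measure set (borelC R) -> \bar R}.
Hypothesis hmu : subsequential_weak_limit (root_counting_measure k Q) mu.

(** Bounds make f a test function, nonnegativity makes its integral against the counting measures a
    plain mean, and the limit of these means passes to the subsequence. *)
Lemma integral_weak_limit (f : Cx R -> R) (M l : R) :
  continuous f -> (forall z, 0 <= f z) -> (forall z, f z <= M) ->
  n.+1%:R^-1 * \sum_(x <- zs n) f x @[n --> \oo] --> l ->
  (\int[mu]_x (f x)%:E = l%:E)%E.
Proof.
move=> cf f0 fM fl; have [s [smono smu]] := hmu.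
have s_ge n : (n <= s n)%N.
  by elim: n => // n IH; apply: (leq_ltn_trans IH); exact: smono.
have soo : s n @[n --> \oo] --> \oo.
  by move=> A [N _ NA]; exists N => // n /= Nn; apply: NA => /=; apply: leq_trans (s_ge n).
have h1 := smu f cf; have {}h1 : (\int[root_counting_measure k Q (s n)]_x (f x)%:E)%E
   @[n --> \oo] --> (\int[mu]_x (f x)%:E)%E.
  by apply: h1; exists M => z; rewrite ger0_norm.
apply: (cvg_unique (@ereal_hausdorff R) h1).
rewrite /= (_ : (fun n => _) = fun n => ((s n).+1%:R^-1 * \sum_(x <- zs (s n)) f x)%:E).
  apply: cvg_EFin; first exact: nearW.
  exact: (cvg_comp _ (fun n => n.+1%:R^-1 * \sum_(x <- zs n) f x) soo fl).
by apply/funext => n; rewrite integral_root_counting_measure.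
Qed.

(** The constant 1 is a test function and there are n + 1 roots for n large, so no mass escapes. *)
Lemma weak_limit_mass : mu setT = 1%E.
Proof.
have := @integral_weak_limit (fun=> 1) 1 1; rewrite (integral_cst mu measurableT 1%E) mul1e.
apply => //; first exact: (@cst_continuous (Cx R) R 1).
apply: (@cvg_near_eq nat R \oo _ (fun=> 1)); last exact: cvg_cst.
apply: filterS (near_size_zeros_spectral_poly hQ) => n sz.
by rewrite big_const_seq count_predT sz iter_addr_0 mulVf // pnatr_eq0.
Qed.

(* g is replaced by its truncation to [-B, B], which is bounded and agrees with g on
   the supports; it is shifted by B because integral_weak_limit needs g >= 0. *)
Lemma weak_limit_integral (g : Cx R -> R) (l r B : R) :
  continuous g -> 0 <= B ->
  (\forall n \near \oo, forall x, x \in zs n -> modulus x <= r) ->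
  (forall z, modulus z <= r -> `|g z| <= B) ->
  n.+1%:R^-1 * \sum_(x <- zs n) g x @[n --> \oo] --> l ->
  mu.-integrable setT (EFin \o g) /\ \int[mu]_x g x = l.
Proof.
move=> cg B0 zr gB gl.
(* A bounded continuous function that vanishes exactly on the disc of radius r. Its means are
   eventually 0, so mu is carried by this disc. *)
pose cut (z : Cx R) := Num.min 1 (Num.max 0 (modulus z - r)).
have ccut : continuous cut.
  move=> z; apply: (@continuous_min R (Cx R) (fun=> 1) _ z).
    exact: (@cst_continuous (Cx R) R).
  apply: (@continuous_max R (Cx R) (fun=> 0) _ z); first exact: (@cst_continuous (Cx R) R).
  by apply: continuousB; [exact: continuous_modulus|exact: (@cst_continuous (Cx R) R)].
have cut0 z : 0 <= cut z by rewrite /cut le_min ler01 le_max lexx.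
have int_cut : (\int[mu]_x (cut x)%:E = 0%:E)%E.
  apply: (@integral_weak_limit _ 1) => //; first by move=> z; rewrite /cut ge_min lexx.
  apply: (@cvg_near_eq nat R \oo _ (fun=> 0)); last exact: cvg_cst.
  apply: filterS zr => n zr; rewrite big_seq big1 ?mulr0 // => x /zr xr.
  by rewrite /cut (max_l (_ : modulus x - r <= 0)) ?subr_le0 // min_r.
have mcut : measurable_fun setT (fun x : borelC R => (cut x)%:E).
  by apply/measurable_EFinP; exact: measurable_continuous.
have aecut : {ae mu, forall z : borelC R, modulus z <= r}.
  have := int_cut; rewrite (eq_integral (fun x : borelC R => `|(cut x)%:E|%E)); last first.
    by move=> x _; rewrite /= ger0_norm.
  move/(ae_eq_integral_abs mu measurableT mcut); apply: filterS => z /(_ I) /= [] cz.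
  rewrite leNgt; apply/negP => rz; move: cz; rewrite /cut.
  have z0 : 0 < modulus z - r by rewrite subr_gt0.
  rewrite max_r ?ltW // => /eqP; rewrite gt_eqF //.
  by rewrite lt_min z0 ltr01.
pose h (z : Cx R) := Num.max (- B) (Num.min B (g z)).
have hle z : - B <= h z <= B.
  rewrite /h le_max lexx /= ge_max ge_min lexx /= andbT.
  by apply: (le_trans _ B0); rewrite oppr_le0.
have hE z : modulus z <= r -> h z = g z.
  move=> /gB; rewrite ler_norml => /andP[gl1 gl2].
  by rewrite /h min_r // max_r.
have ch : continuous h.
  move=> z; apply: (@continuous_max R (Cx R) (fun=> - B) _ z).
    exact: (@cst_continuous (Cx R) R).
  apply: (@continuous_min R (Cx R) (fun=> B) g z); first exact: (@cst_continuous (Cx R) R).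
  exact: cg.
have chB : continuous (fun z => h z + B).
  by move=> z; apply: continuousD; [exact: ch|exact: (@cst_continuous (Cx R) R)].
have int_hB : (\int[mu]_x (h x + B)%:E = (l + B)%:E)%E.
  apply: (@integral_weak_limit _ (B + B)) => //.
  - by move=> z; have /andP[] := hle z; lra.
  - by move=> z; have /andP[] := hle z; lra.
  apply: (@cvg_near_eq nat R \oo _ (fun n => n.+1%:R^-1 * \sum_(x <- zs n) g x + B)).
    near=> n; have zn : forall x, x \in zs n -> modulus x <= r by near: n.
    have sz : size (zs n) = n.+1 by near: n; exact: near_size_zeros_spectral_poly.
    rewrite big_split /= mulrDr big_const_seq count_predT sz iter_addr_0.
    rewrite -[X in _ = _ + _ * X]mulr_natl mulKf ?pnatr_eq0 //.
    congr (_ * _ + _); rewrite big_seq [RHS]big_seq; apply: eq_bigr => x xz.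
    by rewrite hE // zn.
  by apply: cvgD; [exact: gl|exact: cvg_cst].
have mh := measurable_continuous ch; have mg := measurable_continuous cg.
have mufin : (mu setT < +oo)%E by rewrite weak_limit_mass ltry.
have ih : mu.-integrable setT (EFin \o h).
  apply: measurable_bounded_integrable => //; exists B; split; first exact: num_real.
  move=> M BM z _ /=; apply: (le_trans _ (ltW BM)).
  by rewrite ler_norml; exact: hle.
have hg : ae_eq mu setT (EFin \o (g : borelC R -> R)) (EFin \o (h : borelC R -> R)).
  by apply: filterS aecut => z zr' _ /=; rewrite hE.
have ig : mu.-integrable setT (EFin \o g).
  apply/integrableP; split; first exact/measurable_EFinP.
  have /integrableP[_] := ih; congr (_ < _)%E.
  apply: ge0_ae_eq_integral => //.
  - by apply: measurableT_comp => //; exact/measurable_EFinP.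
  - by apply: measurableT_comp => //; exact/measurable_EFinP.
  by apply: filterS aecut => z zr' _ /=; rewrite hE.
split=> //.
have -> : \int[mu]_x g x = \int[mu]_x h x.
  rewrite /Rintegral; congr fine; apply: ae_eq_integral => //; exact/measurable_EFinP.
(* The shift contributes exactly B because mu has total mass 1. *)
have : \int[mu]_x (h x + B) = l + B by rewrite /Rintegral int_hB.
rewrite RintegralD //; last first.
  apply: measurable_bounded_integrable => //; exists B; split; first exact: num_real.
  by move=> M BM z _ /=; rewrite ger0_norm // ltW.
rewrite (_ : \int[mu]_x B = B); first exact: addIr.
by rewrite /Rintegral (integral_cst mu measurableT B%:E) weak_limit_mass mule1.
Unshelve. all: by end_near. Qed.

(** Powers are unbounded when m > 0, hence no test functions, but their real and imaginary parts are
    at most r^m in absolute value on a disc containing all zeros for n large. *)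
Lemma weak_limit_moment m (L : Cx R) :
  mean_power k Q m n @[n --> \oo] --> L ->
  Cintegrable mu setT (fun z : Cx R => z ^+ m) /\
  Cintegral mu setT (fun z : Cx R => z ^+ m) = L.
Proof.
move=> hL.
have [r r0 zr] : exists2 r : R, 0 <= r & \forall n \near \oo,
    forall x, x \in zs n -> modulus x <= r.
  have [C hC] := near_zeros_bounded hQ.
  exists `|complex.Re C| => //; apply: filterS hC => n hC x /hC.
  by rewrite modulusE lecE /= => /andP[_ /le_trans]; apply; exact: ler_norm.
have eqR n : mean_power k Q m n = Complex (n.+1%:R^-1 * \sum_(x <- zs n) complex.Re (x ^+ m))
   (n.+1%:R^-1 * \sum_(x <- zs n) complex.Im (x ^+ m)).
  rewrite /mean_power.
  have -> : (n.+1%:R^-1 : Cx R) = real_complex R n.+1%:R^-1.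
    by rewrite fmorphV /= real_complex_nat.
  have -> : \sum_(x <- zs n) x ^+ m = Complex (\sum_(x <- zs n) complex.Re (x ^+ m))
     (\sum_(x <- zs n) complex.Im (x ^+ m)).
    elim: (zs n) => [|x z IH]; first by rewrite !big_nil.
    by rewrite !big_cons IH; case: (x ^+ m).
  by rewrite /GRing.mul /= !mul0r subr0 addr0.
have zm z : modulus z <= r -> `|z ^+ m| <= real_complex R (r ^+ m).
  move=> zr'; rewrite normrX rmorphXn /=; apply: lerXn2r.
  - exact: normr_ge0.
  - by rewrite nnegrE ler0c.
  - by rewrite modulusE lecR.
have [iRe eRe] : mu.-integrable setT (EFin \o (fun z : Cx R => complex.Re (z ^+ m))) /\
    \int[mu]_x complex.Re (x ^+ m) = complex.Re L.
  apply: (@weak_limit_integral _ _ r (r ^+ m)) => //.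
  - move=> z; apply: (@cvg_complex_Re R (Cx R) (nbhs z) _ (fun x => x ^+ m) (z ^+ m)).
    exact: continuous_exprC.
  - exact: exprn_ge0.
  - by move=> z /zm; rewrite -lecR; apply: le_trans; exact: normc_ge_Re.
  apply: (@cvg_near_eq nat R \oo _ (fun n => complex.Re (mean_power k Q m n))).
    by apply: nearW => n; rewrite eqR.
  exact: (@cvg_complex_Re R nat \oo _ _ _ hL).
have [iIm eIm] : mu.-integrable setT (EFin \o (fun z : Cx R => complex.Im (z ^+ m))) /\
    \int[mu]_x complex.Im (x ^+ m) = complex.Im L.
  apply: (@weak_limit_integral _ _ r (r ^+ m)) => //.
  - move=> z; apply: (@cvg_complex_Im R (Cx R) (nbhs z) _ (fun x => x ^+ m) (z ^+ m)).
    exact: continuous_exprC.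
  - exact: exprn_ge0.
  - by move=> z /zm; rewrite -lecR; apply: le_trans; exact: normc_ge_Im.
  apply: (@cvg_near_eq nat R \oo _ (fun n => complex.Im (mean_power k Q m n))).
    by apply: nearW => n; rewrite eqR.
  exact: (@cvg_complex_Im R nat \oo _ _ _ hL).
by split => //; rewrite /Cintegral eRe eIm; case: (L).
Qed.

End weak_limits.

Theorem theorem2 (R : realType) (k : nat) (Q : nat -> {poly Cx R})
    (hQ : high_order_heun k Q) :
  (* for large n the spectral polynomial has n + 1 zeros *)
  (\forall n \near \oo, size (zeros (spectral_poly k Q n)) = n.+1) /\
  (* normalized operators: Q_k monic and Q_k(0) = 0 *)
  (Q k \is monic -> root (Q k) 0 ->
    forall m : nat, (0 < m)%N ->
    [/\ mean_power k Q m n @[n --> \oo] --> heun_moment k (Q k) m,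
        forall mu : {measure set (borelC R) -> \bar R},
          subsequential_weak_limit (root_counting_measure k Q) mu ->
          Cintegrable mu setT (fun z : Cx R => z ^+ m) /\
          Cintegral mu setT (fun z : Cx R => z ^+ m) = heun_moment k (Q k) m
      & forall (Q' : nat -> {poly Cx R}) (mu mu' : {measure set (borelC R) -> \bar R}),
          high_order_heun k Q' -> Q' k = Q k ->
          subsequential_weak_limit (root_counting_measure k Q) mu ->
          subsequential_weak_limit (root_counting_measure k Q') mu' ->
          Cintegral mu setT (fun z : Cx R => z ^+ m)
            = Cintegral mu' setT (fun z : Cx R => z ^+ m)]) /\
  (* arbitrary operators and affine normalizations z = a u + b *)
  (forall m : nat, (0 < m)%N ->
    (forall a b : Cx R, a != 0 -> root (Q k) b ->
      mean_power k Q m n @[n --> \oo] --> affine_moment k (Q k) a b m) /\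
    (forall a b a' b' : Cx R, a != 0 -> root (Q k) b ->
      a' != 0 -> root (Q k) b' ->
      affine_moment k (Q k) a b m = affine_moment k (Q k) a' b' m)).
Proof.
split; first exact: near_size_zeros_spectral_poly.
split=> [mQ rQ m m0|m m0].
  (* Stated for every operator with leading coefficient Q_k, so that it also yields the dependence
     on Q_k alone. *)
  have moment Q' (mu : {measure set (borelC R) -> \bar R}) : high_order_heun k Q' ->
      Q' k = Q k -> subsequential_weak_limit (root_counting_measure k Q') mu ->
      Cintegrable mu setT (fun z : Cx R => z ^+ m) /\
      Cintegral mu setT (fun z : Cx R => z ^+ m) = heun_moment k (Q k) m.
    move=> hQ' eQ wmu; apply: (weak_limit_moment hQ' wmu).
    by rewrite -eQ in mQ rQ *; exact: cvg_mean_power.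
  split=> [|mu wmu|Q' mu mu' hQ' eQ wmu wmu'].
  - exact: cvg_mean_power.
  - exact: (moment Q).
  - by rewrite (moment Q mu hQ erefl wmu).2 (moment Q' mu' hQ' eQ wmu').2.
split=> [a b a0 rb|a b a' b' a0 rb a'0 rb']; first exact: cvg_mean_power_affine.
(* Both expressions are limits of the same sequence [mean_power k Q m], which does not involve the
   affine normalization. *)
apply: (@cvg_unique (Cx R) _ (mean_power k Q m n @[n --> \oo])).
- exact: norm_hausdorff.
- exact: cvg_mean_power_affine.
- exact: cvg_mean_power_affine.
Qed.
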